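(* Let $K$ be a field of characteristic zero and let $R$ be a finitely generated $\mathbb{N}$-graded $K$-algebra with $R_0=K$. If there exists a nonzerodivisor $f\in R$ in the singular locus of $R$ that admits a Bernstein-Sato polynomial with no nonnegative integer roots (in particular nonzero), then the differential signature of $R$ is positive: $\mathrm{s}^{\mathrm{diff}}_K(R)>0$.
   Context: Differential operators: for a commutative $K$-algebra $R$, $D_{R|K}\subseteq \operatorname{End}_K(R)$ is the ring of $K$-linear differential operators: $D^0_{R|K}$ is the set of multiplication operators by elements of $R$ (identified with $R$), $D^{n+1}_{R|K}=\{\delta\in\operatorname{End}_K(R): [\delta,r]\in D^n_{R|K}\text{ for all } r\in R\}$, and $D_{R|K}=\bigcup_n D^n_{R|K}$. Differential operators on $R$ extend uniquely to differential operators on $R_f$. Singular locus: ''$f$ is in the singular locus of $R$'' means that $f$ lies in every prime $P$ of $R$ such that $R_P$ is not regular; equivalently, $R_f$ is regular. Bernstein-Sato polynomial: a Bernstein-Sato functional equation for $f$ consists of $\delta(s)\in D_{R|K}[s]$ and $b(s)\in K[s]$ such that $\delta(n)(f^{n+1})=b(n)f^n$ in $R_f$ for all $n\in\mathbb{Z}$ (action of operators on elements). The Bernstein-Sato polynomial of $f$ is the minimal monic $b(s)$ occurring in such an equation, if a nonzero one exists. Differential signature: with $\mathfrak{m}=R_{>0}$ and $\mathfrak{m}^{\langle n\rangle_K}=\{f\in R: \delta(f)\in\mathfrak{m}\text{ for all }\delta\in D^{n-1}_{R|K}\}$, set $\mathrm{s}^{\mathrm{diff}}_K(R)=\limsup_{n\to\infty}\frac{\dim(R)!}{n^{\dim(R)}}\dim_K\big(R/\mathfrak{m}^{\langle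 n\rangle_K}\big)$. *)

(* Defs.v *)
From HB Require Import structures.
From mathcomp Require Import all_boot all_order all_algebra.
From mathcomp Require Import generic_quotient ring_quotient ring.
From mathcomp Require Import boolp classical_sets reals ereal sequences.

Set Implicit Arguments.
Unset Strict Implicit.
Unset Printing Implicit Defensive.

Import Order.TTheory GRing.Theory Num.Theory.
Local Open Scope ring_scope.
Local Open Scope quotient_scope.

(* Localization of a commutative ring at a multiplicative set. The set is
   assumed not to contain 0, so that the localization is a nonzero ring; R need
   not be a domain, so x / s = y / t means that u (x t) = u (y s) for some u
   in the multiplicative set. *)

Record denoms (R : comNzRingType) := Denoms {
  denoms_pred :> {pred R};
  denoms1 : 1 \in denoms_pred;
  denomsM : {in denoms_pred &, forall s t, s * t \in denoms_pred};
  denoms0 : 0 \notin denoms_pred }.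

Section Localization.
Variables (R : comNzRingType) (S : denoms R).

Definition den := {s : R | s \in S}.
Implicit Types (x y z : R) (s t : den) (p q r : R * den).

Definition dval s : R := val s.
Arguments dval : simpl never.

Lemma dvalP s : dval s \in S. Proof. exact: valP s. Qed.

Definition den1 : den := exist _ 1 (denoms1 S).
Definition denM s t : den :=
  exist _ (dval s * dval t) (denomsM (dvalP s) (dvalP t)).

Lemma dvalM s t : dval (denM s t) = dval s * dval t. Proof. by []. Qed.
Lemma dval1 : dval den1 = 1. Proof. by []. Qed.
Local Notation denE := (dvalM, dval1).

Definition frac_eqv p q : bool :=
  `[< exists2 u, u \in S & u * (p.1 * dval q.2) = u * (q.1 * dval p.2) >].

Lemma frac_eqv_equiv : equiv_class_of frac_eqv.
Proof.
split=> [p|p q|q p r].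
- by apply/asboolP; exists 1 => //; exact: denoms1.
- by apply/asboolP/asboolP => -[u Su e]; exists u.
- move=> /asboolP[u Su e1] /asboolP[v Sv e2]; apply/asboolP.
  exists (u * v * dval q.2).
    by rewrite !denomsM ?(dvalP q.2).
  transitivity (v * dval r.2 * (u * (p.1 * dval q.2))); first by ring.
  rewrite e1; transitivity (u * dval p.2 * (v * (q.1 * dval r.2))); first by ring.
  by rewrite e2; ring.
Qed.

Canonical frac_eqv_rel := EquivRelPack frac_eqv_equiv.

Definition localization := {eq_quot frac_eqv}.
HB.instance Definition _ : EqQuotient _ frac_eqv localization :=
  EqQuotient.on localization.
HB.instance Definition _ := Choice.on localization.
Implicit Types a b c : localization.

Definition Frac x s : localization := \pi_localization (x, s).

Lemma FracP x s y t :
  Frac x s = Frac y t <-> exists2 u, u \in S & u * (x * dval t) = u * (y * dval s).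
Proof.
rewrite /Frac; split; first by move=> /eqmodP /asboolP.
by move=> h; apply/eqmodP/asboolP.
Qed.

Definition numer a : R := (repr a).1.
Definition denom a : den := (repr a).2.

Lemma FracK a : Frac (numer a) (denom a) = a.
Proof. by rewrite /Frac -surjective_pairing reprK. Qed.

Lemma FracW (P : localization -> Prop) :
  (forall x s, P (Frac x s)) -> forall a, P a.
Proof. by move=> h a; rewrite -(FracK a). Qed.

Definition loc_add a b :=
  Frac (numer a * dval (denom b) + numer b * dval (denom a))
       (denM (denom a) (denom b)).
Definition loc_opp a := Frac (- numer a) (denom a).
Definition loc_mul a b := Frac (numer a * numer b) (denM (denom a) (denom b)).
Definition loc_inj x := Frac x den1.

Lemma loc_addE x s y t :
  loc_add (Frac x s) (Frac y t) = Frac (x * dval t + y * dval s) (denM s t).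
Proof.
have /FracP[u Su e1] := FracK (Frac x s).
have /FracP[v Sv e2] := FracK (Frac y t).
apply/FracP; exists (u * v); first exact: denomsM.
rewrite ?denE.
move: (numer (Frac x s)) (denom (Frac x s)) e1 => x' s' e1 /=.
move: (numer (Frac y t)) (denom (Frac y t)) e2 => y' t' e2 /=.
transitivity (v * dval t * dval t' * (u * (x' * dval s)) +
              u * dval s * dval s' * (v * (y' * dval t))); first by ring.
by rewrite e1 e2; ring.
Qed.

Lemma loc_oppE x s : loc_opp (Frac x s) = Frac (- x) s.
Proof.
have /FracP[u Su e1] := FracK (Frac x s).
by apply/FracP; exists u; rewrite // !mulNr !mulrN e1.
Qed.

Lemma loc_mulE x s y t :
  loc_mul (Frac x s) (Frac y t) = Frac (x * y) (denM s t).
Proof.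
have /FracP[u Su e1] := FracK (Frac x s).
have /FracP[v Sv e2] := FracK (Frac y t).
apply/FracP; exists (u * v); first exact: denomsM.
rewrite ?denE.
move: (numer (Frac x s)) (denom (Frac x s)) e1 => x' s' e1 /=.
move: (numer (Frac y t)) (denom (Frac y t)) e2 => y' t' e2 /=.
transitivity ((u * (x' * dval s)) * (v * (y' * dval t))); first by ring.
by rewrite e1 e2; ring.
Qed.

Lemma Frac_eq x s y t : x * dval t = y * dval s -> Frac x s = Frac y t.
Proof. by move=> e; apply/FracP; exists 1; rewrite ?denoms1 ?e. Qed.

Lemma loc_addA : associative loc_add.
Proof.
elim/FracW=> x s; elim/FracW=> y t; elim/FracW=> z w.
by rewrite !loc_addE; apply: Frac_eq; rewrite ?denE; ring.
Qed.

Lemma loc_addC : commutative loc_add.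
Proof.
elim/FracW=> x s; elim/FracW=> y t.
by rewrite !loc_addE; apply: Frac_eq; rewrite ?denE; ring.
Qed.

Lemma loc_add0 : left_id (loc_inj 0) loc_add.
Proof.
by elim/FracW=> x s; rewrite loc_addE; apply: Frac_eq; rewrite ?denE; ring.
Qed.

Lemma loc_addN : left_inverse (loc_inj 0) loc_opp loc_add.
Proof.
by elim/FracW=> x s; rewrite loc_oppE loc_addE; apply: Frac_eq; rewrite ?denE; ring.
Qed.

HB.instance Definition _ :=
  GRing.isZmodule.Build localization loc_addA loc_addC loc_add0 loc_addN.

Lemma loc_mulA : associative loc_mul.
Proof.
elim/FracW=> x s; elim/FracW=> y t; elim/FracW=> z w.
by rewrite !loc_mulE; apply: Frac_eq; rewrite ?denE; ring.
Qed.

Lemma loc_mulC : commutative loc_mul.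
Proof.
elim/FracW=> x s; elim/FracW=> y t.
by rewrite !loc_mulE; apply: Frac_eq; rewrite ?denE; ring.
Qed.

Lemma loc_mul1 : left_id (loc_inj 1) loc_mul.
Proof.
by elim/FracW=> x s; rewrite loc_mulE; apply: Frac_eq; rewrite ?denE; ring.
Qed.

Lemma loc_mulDl : left_distributive loc_mul loc_add.
Proof.
elim/FracW=> x s; elim/FracW=> y t; elim/FracW=> z w.
by rewrite !(loc_addE, loc_mulE); apply: Frac_eq; rewrite ?denE; ring.
Qed.

Lemma loc_1neq0 : loc_inj 1 != loc_inj 0.
Proof.
apply/eqP => /FracP[u Su]; rewrite !mulr1 mulr0 => u0.
by have := denoms0 S; rewrite -u0 Su.
Qed.

HB.instance Definition _ := GRing.Zmodule_isComNzRing.Build localization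
  loc_mulA loc_mulC loc_mul1 loc_mulDl loc_1neq0.

Lemma loc_inj_zmod : zmod_morphism loc_inj.
Proof.
move=> x y; rewrite -[RHS]/(loc_add _ (loc_opp _)) loc_oppE loc_addE.
by apply: Frac_eq; rewrite ?denE; ring.
Qed.

Lemma loc_inj_monoid : monoid_morphism loc_inj.
Proof.
split=> // x y; rewrite -[RHS]/(loc_mul _ _) loc_mulE.
by apply: Frac_eq; rewrite ?denE; ring.
Qed.

HB.instance Definition _ :=
  GRing.isZmodMorphism.Build R localization loc_inj loc_inj_zmod.
HB.instance Definition _ :=
  GRing.isMonoidMorphism.Build R localization loc_inj loc_inj_monoid.

Definition loc_unit : {pred localization} := [pred a | `[< exists b, b * a = 1 >]].
Definition loc_inv a : localization :=
  if pselect (exists b, b * a = 1) is left h then projT1 (cid h) else a.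

Lemma loc_mulV : {in loc_unit, left_inverse 1 loc_inv *%R}.
Proof.
move=> a /asboolP ha; rewrite /loc_inv; case: pselect => // h.
exact: projT2 (cid h).
Qed.

Lemma loc_unitP a b : b * a = 1 -> loc_unit a.
Proof. by move=> e; apply/asboolP; exists b. Qed.

Lemma loc_inv_out : {in [predC loc_unit], loc_inv =1 id}.
Proof.
move=> a /asboolP ha; rewrite /loc_inv; case: pselect => // h.
Qed.

HB.instance Definition _ := GRing.ComNzRing_hasMulInverse.Build localization
  loc_mulV loc_unitP loc_inv_out.

Lemma loc_inj_unit x : x \in S -> loc_inj x \is a GRing.unit.
Proof.
move=> Sx; apply/unitrP; exists (Frac 1 (exist _ x Sx)).
suff e : Frac 1 (exist _ x Sx) * loc_inj x = 1 by split; rewrite // mulrC.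
by rewrite -[LHS]/(loc_mul _ _) loc_mulE; apply: Frac_eq;
   rewrite ?denE /dval /=; ring.
Qed.

Lemma FracE x s : Frac x s = loc_inj x / loc_inj (dval s).
Proof.
apply: (mulIr (loc_inj_unit (dvalP s))); rewrite divrK ?loc_inj_unit ?dvalP //.
by rewrite -[LHS]/(loc_mul _ _) loc_mulE; apply: Frac_eq; rewrite ?denE; ring.
Qed.

End Localization.

Section LocalizationAlgebra.
Variables (K : comNzRingType) (R : comAlgType K) (S : denoms R).
Local Notation L := (localization S).

Definition loc_scale (c : K) (a : L) : L := loc_inj S c%:A * a.

Lemma loc_scaleA a b v : loc_scale a (loc_scale b v) = loc_scale (a * b) v.
Proof. by rewrite /loc_scale mulrA -rmorphM /= -scalerAl mul1r scalerA. Qed.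

Lemma loc_scale1 : left_id 1 loc_scale.
Proof. by move=> v; rewrite /loc_scale scale1r rmorph1 mul1r. Qed.

Lemma loc_scaleDr : right_distributive loc_scale +%R.
Proof. by move=> c u v; rewrite /loc_scale mulrDr. Qed.

Lemma loc_scaleDl v : {morph loc_scale^~ v : a b / a + b}.
Proof. by move=> a b; rewrite /loc_scale scalerDl rmorphD mulrDl. Qed.

HB.instance Definition _ := GRing.Zmodule_isLmodule.Build K L
  loc_scaleA loc_scale1 loc_scaleDr loc_scaleDl.

Lemma loc_scaleAl (c : K) (u v : L) : c *: (u * v) = (c *: u) * v.
Proof. exact: mulrA. Qed.

HB.instance Definition _ := GRing.Lmodule_isLalgebra.Build K L loc_scaleAl.
HB.instance Definition _ := GRing.Lalgebra_isComAlgebra.Build K L.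

End LocalizationAlgebra.

Section Denoms.
Variable R : comNzRingType.

Lemma compl_prime1 (P : prime_idealr R) : 1 \in [predC P].
Proof. by rewrite inE /= idealr1. Qed.

Lemma compl_primeM (P : prime_idealr R) :
  {in [predC P] &, forall s t, s * t \in [predC P]}.
Proof.
by move=> s t; rewrite !inE /= prime_idealrM => /negbTE-> /negbTE->.
Qed.

Lemma compl_prime0 (P : prime_idealr R) : 0 \notin [predC P].
Proof. by rewrite inE /= negbK idealr0. Qed.

Definition compl_prime (P : prime_idealr R) : denoms R :=
  Denoms (compl_prime1 P) (@compl_primeM P) (compl_prime0 P).

Definition powers_pred (f : R) : {pred R} := [pred x | `[< exists n, x = f ^+ n >]].

Lemma powers1 (f : R) : 1 \in powers_pred f.
Proof. by apply/asboolP; exists 0%N. Qed.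

Lemma powersM (f : R) :
  {in powers_pred f &, forall s t, s * t \in powers_pred f}.
Proof.
move=> s t /asboolP[m ->] /asboolP[n ->]; apply/asboolP.
by exists (m + n)%N; rewrite exprD.
Qed.

Lemma powers0 (f : R) (hf : GRing.lreg f) : 0 \notin powers_pred f.
Proof.
apply/asboolP => -[n /esym fn0]; have := @lregX _ f n hf.
by rewrite fn0 => /lreg_neq0; rewrite eqxx.
Qed.

Definition powers (f : R) (hf : GRing.lreg f) : denoms R :=
  Denoms (powers1 f) (@powersM f) (powers0 hf).

End Denoms.

Definition loc_at (R : comNzRingType) (P : prime_idealr R) : comUnitRingType :=
  localization (compl_prime P).

Definition loc_away (K : fieldType) (R : comAlgType K) (f : R)
    (hf : GRing.lreg f) : comUnitAlgType K :=
  localization (powers hf).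

Section Dimension.
Variable A : comNzRingType.

Definition prime_chain (d : nat) (P : 'I_d.+1 -> prime_idealr A) : Prop :=
  forall i j : 'I_d.+1, (i < j)%N ->
    {subset P i <= P j} /\ exists2 x, x \in P j & x \notin P i.

Definition is_krull_dim (d : nat) : Prop :=
  (exists P : 'I_d.+1 -> prime_idealr A, prime_chain P) /\
  (forall e (P : 'I_e.+1 -> prime_idealr A), prime_chain P -> (e <= d)%N).

(* Junk value 0 when the dimension is infinite, which does not happen for
   finitely generated algebras over a field. *)
Definition krull_dim : nat := xget 0%N is_krull_dim.

Definition generates n (g : 'I_n -> A) (I : {pred A}) : Prop :=
  forall x, x \in I <-> exists c : 'I_n -> A, x = \sum_i c i * g i.

(* [idealr] only has proper ideals; the unit ideal is generated by 1. *)
Definition noetherian : Prop :=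
  forall I : idealr A, exists n (g : 'I_n -> A), generates g I.

Definition maximal_ideal (M : idealr A) : Prop :=
  forall J : idealr A, {subset M <= J} -> {subset J <= M}.

Definition local_ring (M : idealr A) : Prop :=
  maximal_ideal M /\ forall N : idealr A, maximal_ideal N -> N =i M.

Definition regular_local_ring : Prop :=
  noetherian /\ exists M : idealr A, local_ring M /\
    exists2 d, is_krull_dim d & exists g : 'I_d -> A, generates g M.

End Dimension.

Definition in_singular_locus (R : comNzRingType) (f : R) : Prop :=
  forall P : prime_idealr R, ~ regular_local_ring (loc_at P) -> f \in P.

Section DiffOp.
Variables (K : fieldType) (A : comAlgType K).

(* [diffop_le n] is D^n, as a set of maps A -> A. *)
Fixpoint diffop_le (n : nat) (delta : A -> A) : Prop :=
  if n is n'.+1 then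
    linear delta /\
    forall r, diffop_le n' (fun x => delta (r * x) - r * delta x)
  else exists r, delta = (fun x => r * x).

Definition diffop (delta : A -> A) : Prop := exists n, diffop_le n delta.

End DiffOp.

Section BernsteinSato.
Variables (K : fieldType) (R : comAlgType K) (f : R) (hf : GRing.lreg f).
Local Notation Rf := (loc_away hf).
Local Notation toRf := (loc_inj (powers hf)).

(* The extension to R_f of an operator on R, which exists and is unique. *)
Definition diffop_extends (delta : R -> R) (delta' : Rf -> Rf) : Prop :=
  diffop delta' /\ forall r, delta' (toRf r) = toRf (delta r).

(* delta(s) is the polynomial sum_(i < m) delta_i s^i, and [ext i] is the
   extension of delta_i to R_f. The powers are integer powers in R_f, where f
   is a unit. *)
Definition bs_equation m (delta : 'I_m -> R -> R) (b : {poly K}) : Prop :=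
  (forall i, diffop (delta i)) /\
  exists ext : 'I_m -> Rf -> Rf,
    (forall i, diffop_extends (delta i) (ext i)) /\
    forall n : int,
      \sum_(i < m) (n%:~R : K) ^+ i *: ext i (toRf f ^ (n + 1)) =
      b.[n%:~R] *: toRf f ^ n.

Definition bs_occurs (b : {poly K}) : Prop :=
  exists m (delta : 'I_m -> R -> R), bs_equation delta b.

Definition is_bs_poly (b : {poly K}) : Prop :=
  [/\ b \is monic, bs_occurs b &
      forall b' : {poly K}, b' \is monic -> bs_occurs b' ->
        (size b <= size b')%N].

End BernsteinSato.

Section Graded.
Variables (K : fieldType) (R : comAlgType K).

Definition fin_gen_alg : Prop :=
  exists n (g : 'I_n -> R), forall A : subalgClosed R,
    (forall i, g i \in A) -> forall r, r \in A.

Record grading (G : nat -> submodClosed R) : Prop := Grading {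
  grading_span : forall r, exists n (u : nat -> R),
    (forall i, u i \in G i) /\ r = \sum_(i < n) u i;
  grading_direct : forall n (u : nat -> R), (forall i, u i \in G i) ->
    \sum_(i < n) u i = 0 -> forall i, (i < n)%N -> u i = 0;
  grading_one : 1 \in G 0%N;
  grading_mul : forall i j x y, x \in G i -> y \in G j ->
    x * y \in G (i + j)%N }.

Definition grading_connected (G : nat -> submodClosed R) : Prop :=
  forall r, r \in G 0%N <-> exists c : K, r = c%:A.

Definition irrelevant_ideal (G : nat -> submodClosed R) (r : R) : Prop :=
  exists n (u : nat -> R),
    (forall i, u i \in G i) /\ r = \sum_(1 <= i < n) u i.

(* The index n = 0 (for which n.-1 = 0) plays no role in the limit superior
   below. *)
Definition diff_power (G : nat -> submodClosed R) (n : nat) (r : R) : Prop :=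
  forall delta, diffop_le n.-1 delta -> irrelevant_ideal G (delta r).

(* The classes of the e i form a K-basis of R / W. *)
Definition quotient_basis (W : set R) k (e : 'I_k -> R) : Prop :=
  (forall c : 'I_k -> K, W (\sum_i c i *: e i) -> forall i, c i = 0) /\
  (forall r, exists c : 'I_k -> K, W (r - \sum_i c i *: e i)).

Definition quotient_dim (RR : realType) (W : set R) : \bar RR :=
  xget +oo%E [set x | exists k (e : 'I_k -> R),
    quotient_basis W e /\ x = k%:R%:E].

Definition diff_signature (RR : realType) (G : nat -> submodClosed R) :
    \bar RR :=
  limn_esup (fun n => let d := krull_dim R in
    ((d`!%:R / n%:R ^+ d)%:E * quotient_dim RR (diff_power G n))%E).

End Graded.

(* Main.v *)
(* A Bernstein-Sato equation without nonnegative integer roots gives operators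
   of order linear in n sending f^n to 1. Let V_n be the space of polynomials
   of degree less than n in each of d = dim R algebraically independent
   elements of R. The claim is that for some C every nonzero F in V_n is sent
   to 1 by an operator of order at most Cn; then V_n injects into
   R / m^<Cn+1>, whose dimension is therefore at least n^d.

   R is a domain: R_P is a domain for f not in P, so if ab = 0 with a, b
   nonzero, then f^n = u + v with ua = 0 = vb, and an operator sending f^n to 1
   sends u and v to zero divisors, which lie in the irrelevant ideal.

   The set X of those a in R for which some C makes a^(Cn) reachable from every
   nonzero F in V_n by operators of order Cn is an ideal stable under
   derivations, as a^N -> (Ea)^(2N) takes N applications of the derivation E.
   It contains a common denominator h of the partial derivatives with respect to
   the d elements, so it is nonzero. At a prime P not containing f, regularity
   provides parameters x_i of R_P and derivations D_i with D_i x_j = delta_ij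
   that preserve R_P up to denominators, and by Euler's formula a nonzero ideal
   stable under derivations is not contained in P. Hence X contains a power of
   f, and composing with the operators above gives the claim. *)

Require Import Defs.
From mathcomp Require Import all_boot all_order all_algebra.
From mathcomp Require Import boolp classical_sets reals ereal sequences.
From HB Require Import structures.
From mathcomp Require Import generic_quotient ring_quotient ring zify.
From mathcomp Require Import filter normedtype.
Set Implicit Arguments.
Unset Strict Implicit.
Unset Printing Implicit Defensive.
Import Order.TTheory GRing.Theory Num.Theory.
Local Open Scope ring_scope.

(** * Ideals and fraction fields *)

Section Ideals.
Variable A : comNzRingType.
Implicit Types (I : A -> Prop) (a b x : A).

(** Prop-valued ideals, with the unit ideal allowed: annihilators, powers of ideals and sets of
    reachable elements are treated as ideals before anything is known about properness. *)
Record is_ideal I : Prop := IsIdeal {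
  ideal0 : I 0;
  idealD : forall a b, I a -> I b -> I (a + b);
  idealMl : forall a b, I b -> I (a * b) }.

Lemma ideal_sum I (T : Type) (r : seq T) (P : pred T) (F : T -> A) :
  is_ideal I -> (forall i, P i -> I (F i)) -> I (\sum_(i <- r | P i) F i).
Proof. by move=> hI hF; elim/big_ind: _ => //; [exact: ideal0|move=> a b; exact: idealD]. Qed.

Lemma ideal_mulr I a b : is_ideal I -> I a -> I (a * b).
Proof. by move=> hI Ia; rewrite mulrC; apply: idealMl. Qed.

Lemma idealB I a b : is_ideal I -> I a -> I b -> I (a - b).
Proof. by move=> hI Ia Ib; apply: idealD => //; rewrite -mulN1r; apply: idealMl. Qed.

Lemma idealX I a m n : is_ideal I -> (m <= n)%N -> I (a ^+ m) -> I (a ^+ n).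
Proof. by move=> hI /subnK <- Ia; rewrite exprD; apply: idealMl. Qed.

Lemma idealr_is_ideal (J : idealr A) : is_ideal (fun a => a \in J).
Proof.
by split=> [|a b|a b]; [exact: idealr0|exact: rpredD|exact: idealMr].
Qed.

Lemma zero_is_ideal : is_ideal (fun a => a = 0).
Proof. by split=> [//|_ _ -> ->|b _ ->]; rewrite ?addr0 ?mulr0. Qed.

Lemma bundle_ideal I : is_ideal I -> ~ I 1 ->
  exists J : idealr A, forall a, a \in J <-> I a.
Proof.
move=> hI I1; pose P : A -> bool := fun a => `[< I a >].
have hP : idealr_closed P.
  split; first by apply/asboolP; apply: ideal0.
    by apply/asboolP.
  move=> a u v /asboolP Iu /asboolP Iv; apply/asboolP.
  by apply: idealD => //; apply: idealMl.
pose J : idealr A := HB.pack P (isIdealr.Build A P hP).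
by exists J => a; split=> /asboolP.
Qed.

Lemma bundle_prime I : is_ideal I -> ~ I 1 ->
    (forall a b, I (a * b) -> I a \/ I b) ->
  exists J : prime_idealr A, forall a, a \in J <-> I a.
Proof.
move=> hI I1 pI; pose P : A -> bool := fun a => `[< I a >].
have hP : idealr_closed P.
  split; first by apply/asboolP; apply: ideal0.
    by apply/asboolP.
  move=> a u v /asboolP Iu /asboolP Iv; apply/asboolP.
  by apply: idealD => //; apply: idealMl.
have pP : prime_idealr_closed P.
  by move=> a b /asboolP/pI [h|h]; apply/orP; [left|right]; apply/asboolP.
pose J : prime_idealr A :=
  HB.pack P (isIdealr.Build A P hP) (isPrimeIdealrClosed.Build A P pP).
by exists J => a; split=> /asboolP.
Qed.

Lemma bigcup_ideal (T : Type) (F : T -> A -> Prop) (dom : T -> Prop) (t0 : T) :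
    dom t0 -> (forall t, dom t -> is_ideal (F t)) ->
    (forall s t, dom s -> dom t ->
      (forall a, F s a -> F t a) \/ (forall a, F t a -> F s a)) ->
  is_ideal (fun a => exists2 t, dom t & F t a).
Proof.
move=> d0 hF tot; split=> [|a b [s ds Fa] [t dt Fb]|a b [t dt Fb]].
- by exists t0 => //; apply: ideal0; apply: hF.
- have [h|h] := tot s t ds dt.
  + by exists t => //; apply: idealD => //; [exact: hF|exact: h].
  + by exists s => //; apply: idealD => //; [exact: hF|exact: h].
- by exists t => //; apply: idealMl => //; apply: hF.
Qed.

(** Zorn's lemma. The last clause expresses maximality: enlarging [L] by any [b] outside it hits
    [X]. Below, [X] is the set of powers of an element, or a single element. *)
Lemma maximal_avoiding I (X : A -> Prop) : is_ideal I ->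
    (forall a, I a -> ~ X a) ->
  exists L : A -> Prop, [/\ is_ideal L, forall a, I a -> L a,
    forall a, L a -> ~ X a &
    forall b, ~ L b -> exists a c, L a /\ X (a + c * b)].
Proof.
move=> hI IX.
pose P (L : set A) := (forall a, ~ L a) \/
   [/\ is_ideal L, forall a, I a -> L a & forall a, L a -> ~ X a].
have [F FP Ftot|L [PL Lmax]] := @Zorn_bigcup A P.
  have [[L0 FL0 [a0 La0]]|noL] := pselect (exists2 L, F L & exists a, L a); last first.
    by left=> a [L FL La]; apply: noL; exists L => //; exists a.
  have good L : F L -> (exists a, L a) ->
      [/\ is_ideal L, forall a, I a -> L a & forall a, L a -> ~ X a].
    by move=> FL [a La]; have [h|//] := FP _ FL; case: (h a).
  right; split.
  - have := @bigcup_ideal _ (fun L : set A => L) (fun L => F L /\ exists a, L a) L0.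
    case; [by split=> //; exists a0|by move=> t [Ft /(good _ Ft)[]]| |].
      by move=> s t [Fs _] [Ft _]; have [] := Ftot _ _ Fs Ft; [left|right].
    move=> [L [FL _] h0] hD hM; split=> [|a b [s Fs sa] [t Ft tb]|a b [t Ft tb]].
    + by exists L.
    + have [||u [Fu _] ub] := hD a b; [by exists s => //; split=> //; exists a|
        by exists t => //; split=> //; exists b|by exists u].
    + have [|u [Fu _] ub] := hM a b; first by exists t => //; split=> //; exists b.
      by exists u.
  - have [_ h _] := good _ FL0 (ex_intro _ a0 La0).
    by move=> a Ia; exists L0 => //; apply: h.
  - by move=> a [L FL La]; have [_ _] := good _ FL (ex_intro _ a La); apply.
have {PL}[L0|[hL IL LX]] := PL.
  case: (Lmax I); last by right; split.
  split; first by move=> a /L0.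
  by move=> /(_ 0 (ideal0 hI)); apply: L0.
exists L; split=> // b Lb; apply: contrapT => nX.
pose L' a := exists l c, L l /\ a = l + c * b.
have LL' a : L a -> L' a by move=> La; exists a, 0; rewrite mul0r addr0.
apply: (Lmax L').
  split=> // h; apply: Lb; apply: h; exists 0, 1.
  by rewrite mul1r add0r; split=> //; apply: ideal0.
right; split; first split.
- by apply: LL'; apply: ideal0.
- move=> _ _ [l [c [Ll ->]]] [l' [c' [Ll' ->]]].
  by exists (l + l'), (c + c'); split; [exact: idealD|ring].
- move=> a _ [l [c [Ll ->]]].
  by exists (a * l), (a * c); split; [exact: idealMl|ring].
- by move=> a /IL/LL'.
- by move=> _ [l [c [Ll ->]]] Xl; apply: nX; exists l, c.
Qed.

(** An ideal [L] maximal among those without a power of [f] is prime: if neither a nor b lies in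
    [L], both enlargements contain a power of [f], and the product of these powers lies in L +
    (ab). *)
Lemma prime_avoiding_powers I f : is_ideal I -> (forall n, ~ I (f ^+ n)) ->
  exists P : prime_idealr A, (forall a, I a -> a \in P) /\ f \notin P.
Proof.
move=> hI If.
have [|L [hL IL Lf Lmax]] := @maximal_avoiding I (fun a => exists n, a = f ^+ n) hI.
  by move=> a Ia [n ea]; apply: (If n); rewrite -ea.
have [|a b Lab|P hP] := @bundle_prime L hL.
- by move=> L1; apply: Lf L1 _; exists 0%N.
- apply: contrapT => /not_orP[La Lb].
  have [l [c [Ll [n en]]]] := Lmax a La; have [l' [c' [Ll' [n' en']]]] := Lmax b Lb.
  case: (Lf (f ^+ (n + n'))); last by exists (n + n')%N.
  rewrite exprD -en -en'.
  have -> : (l + c * a) * (l' + c' * b) =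
    l' * l + c' * b * l + c * a * l' + c * c' * (a * b) by ring.
  by do ![apply: idealD => //]; apply: idealMl.
exists P; split=> [a /IL/hP//|]; apply/negP => /hP/Lf; apply.
by exists 1%N.
Qed.

End Ideals.

Section DomainQuotient.
Variables (A : comNzRingType) (P : prime_idealr A).

(** Units and inverses are supplied by classical choice, so that A/P becomes an [idomainType] and
    has a fraction field. *)
Definition domain_quot := {ideal_quot P}.
HB.instance Definition _ := GRing.ComNzRing.on domain_quot.

Definition dq_unit : {pred domain_quot} := [pred a | `[< exists b, b * a = 1 >]].
Definition dq_inv (a : domain_quot) : domain_quot :=
  if pselect (exists b, b * a = 1) is left h then projT1 (cid h) else a.

Lemma dq_mulV : {in dq_unit, left_inverse 1 dq_inv *%R}.
Proof.
move=> a /asboolP ha; rewrite /dq_inv; case: pselect => // h.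
exact: projT2 (cid h).
Qed.

Lemma dq_unitP (a b : domain_quot) : b * a = 1 -> dq_unit a.
Proof. by move=> e; apply/asboolP; exists b. Qed.

Lemma dq_inv_out : {in [predC dq_unit], dq_inv =1 id}.
Proof. by move=> a /asboolP ha; rewrite /dq_inv; case: pselect. Qed.

HB.instance Definition _ := GRing.ComNzRing_hasMulInverse.Build domain_quot
  dq_mulV dq_unitP dq_inv_out.

HB.instance Definition _ := GRing.ComUnitRing_isIntegral.Build domain_quot
  (@Quotient.rquot_IdomainAxiom A P).

End DomainQuotient.

Lemma fraction_pi (Q : idomainType) (r : {ratio Q}) :
  (\pi_({fraction Q})%qT r : {fraction Q}) = tofrac \n_r / tofrac \d_r.
Proof.
have d0 : \d_r != 0 by exact: denom_ratioP.
apply: (mulIf (x := tofrac \d_r)); first by rewrite tofrac_eq0.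
rewrite divfK ?tofrac_eq0 //; apply/eqP.
rewrite -[GRing.mul]/(@FracField.mul Q) !piE FracField.equivfE /FracField.mulf.
by rewrite !numden_Ratio ?mulf_neq0 ?oner_eq0 // !mulr1 mulrC.
Qed.

(** The field is Frac(A/P). It serves as a residue field, as the fraction field of a domain, and as
    the fraction field of a local ring modulo a prime. *)
Lemma exists_fraction_field (A : comNzRingType) (P : prime_idealr A) :
  exists (F : fieldType) (phi : {rmorphism A -> F}),
    (forall a, phi a = 0 <-> a \in P) /\
    (forall z, exists a b, b \notin P /\ z = phi a / phi b).
Proof.
pose Q : idomainType := domain_quot P.
pose pi : {rmorphism A -> Q} := \pi_({ideal_quot P})%qT.
pose F : fieldType := {fraction Q}.
pose phi : {rmorphism A -> F} := (@tofrac Q) \o pi.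
have pi0 a : pi a = 0 <-> a \in P.
  have := Quotient.idealrBE P a 0; rewrite subr0 => ->.
  by split=> [h|/eqP e]; [apply/eqP; rewrite -/pi rmorph0 | rewrite [LHS]e rmorph0].
have phi0 a : phi a = 0 <-> a \in P.
  rewrite -pi0 /phi /=; split=> [/eqP|->]; last exact: rmorph0.
  by rewrite tofrac_eq0 => /eqP.
exists F, phi; split=> // z.
elim/quotP: z => r _; exists (repr \n_r), (repr \d_r).
have d0 : \d_r != 0 by exact: denom_ratioP.
have piK (q : Q) : pi (repr q) = q by exact: reprK.
split; first by apply/negP => /pi0; rewrite piK => e; rewrite e eqxx in d0.
rewrite /phi /= !piK.
exact: fraction_pi.
Qed.

(** * Krull's intersection theorem *)

Section IdealPowers.
Variables (A : comNzRingType) (c : nat) (x : 'I_c -> A).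

(** The k-th power of the ideal generated by the [x i], with one generator split off at a time. *)
Fixpoint mpow (k : nat) (a : A) : Prop :=
  if k is k'.+1 then
    exists b : 'I_c -> A, (forall i, mpow k' (b i)) /\ a = \sum_i x i * b i
  else True.

Lemma mpow_ideal k : is_ideal (mpow k).
Proof.
elim: k => [|k IH]; first by [].
split=> [|_ _ [b [hb ->]] [b' [hb' ->]]|a _ [b [hb ->]]].
- exists (fun=> 0); split=> [i|]; first exact: (ideal0 IH).
  by rewrite big1 // => i _; rewrite mulr0.
- exists (fun i => b i + b' i); split=> [i|]; first exact: (idealD IH (hb i) (hb' i)).
  by rewrite -big_split /=; apply: eq_bigr => i _; rewrite mulrDr.
- exists (fun i => a * b i); split=> [i|]; first exact: (idealMl IH _ (hb i)).
  by rewrite mulr_sumr; apply: eq_bigr => i _; rewrite mulrCA.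
Qed.

Lemma mpow_gen k i a : mpow k a -> mpow k.+1 (x i * a).
Proof.
move=> ha; exists (fun j => if j == i then a else 0); split=> [j|].
  by case: eqP => // _; exact: (ideal0 (mpow_ideal k)).
rewrite (bigD1 i) //= eqxx big1 ?addr0 // => j /negbTE ->.
by rewrite mulr0.
Qed.

(** By pigeonhole, a monomial of degree above the sum of the [m i] is divisible by some x_i^(m_i).
    The induction moves generators one by one into a monomial in front. *)
Lemma mpow_nilp (L : A -> Prop) (m : 'I_c -> nat) : is_ideal L ->
  (forall i, L (x i ^+ m i)) -> exists k, forall a, mpow k a -> L a.
Proof.
move=> hL Lx; exists (\sum_i m i).+1.
suff H k : forall (e : 'I_c -> nat) a, (\sum_i m i < \sum_i e i + k)%N ->
    mpow k a -> L ((\prod_i x i ^+ e i) * a).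
  move=> a ha; have -> : a = (\prod_i x i ^+ 0) * a by rewrite big1 ?mul1r.
  by apply: (H _ (fun=> 0%N) _ _ ha); rewrite big1_eq.
elim: k => [|k IH] e a.
  rewrite addn0 => lt_m _; apply: ideal_mulr => //.
  have [i hi] : exists i, (m i <= e i)%N.
    apply: contrapT => /forallNP h; move: lt_m; rewrite ltnNge leq_sum // => i _.
    by have /negP := h i; rewrite -ltnNge => /ltnW.
  rewrite (bigD1 i) //=; apply: ideal_mulr => //.
  by apply: idealX hi _ => //.
move=> lt_m [b [hb ->]]; rewrite mulr_sumr; apply: (@ideal_sum _ _ 'I_c) => // i _.
pose e' j := (e j + (j == i))%N.
have -> : (\prod_j x j ^+ e j) * (x i * b i) = (\prod_j x j ^+ e' j) * b i.
  rewrite mulrA; congr (_ * _); rewrite (bigD1 i) //= [RHS](bigD1 i) //= /e' eqxx.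
  rewrite addn1 exprSr -!mulrA; congr (_ * _); rewrite mulrC; congr (_ * _).
  by apply: eq_bigr => j /negbTE ->; rewrite addn0.
have es : (\sum_j (j == i) = 1)%N.
  by rewrite (bigD1 i) //= eqxx big1 // => j /negbTE ->.
by apply: IH (hb i); rewrite big_split /= es -addnA add1n.
Qed.

End IdealPowers.

Lemma noetherian_chain (A : comNzRingType) (I : nat -> A -> Prop) :
    noetherian A -> (forall n, is_ideal (I n)) ->
    (forall m n a, (m <= n)%N -> I m a -> I n a) ->
  exists N, forall n a, I n a -> I N a.
Proof.
move=> noeA hI mono.
(* [noetherian] speaks of proper ideals only, so a chain that reaches 1 is treated first. *)
have [[N I1]|n1] := pselect (exists n, I n 1).
  by exists N => n a _; rewrite -[a]mulr1; apply: idealMl.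
have hU : is_ideal (fun a => exists2 n, True & I n a).
  apply: bigcup_ideal 0%N _ _ _ => // m n _ _.
  by have [h|/ltnW h] := leqP m n; [left|right] => a; apply: mono.
have [|J hJ] := bundle_ideal hU; first by move=> [n _ In]; apply: n1; exists n.
have [m [g hg]] := noeA J.
have /all_sig[k hk] i : {n | I n (g i)}.
  apply: cid; have /hJ[n _ In] : g i \in J; last by exists n.
  apply/hg; exists (fun j => (j == i)%:R).
  by rewrite (bigD1 i) //= eqxx mul1r big1 ?addr0 // => j /negbTE->; rewrite mul0r.
exists (\max_i k i) => n a Ia.
have /hg[d ->] : a \in J by apply/hJ; exists n.
apply: ideal_sum => // i _; apply: idealMl => //.
by apply: mono (hk i); apply: (leq_bigmax i).
Qed.

(** Suppose a is nonzero and let [L] be maximal among the ideals not containing a. Then x_i a lies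
    in [L], because 1 - x_i d is a unit. The colon ideals (L : x_i^n) stabilise, which forces a
    power of each x_i into [L]. Hence [L] contains a power of the ideal (x), and so a. *)
Lemma krull_intersection (A : comNzRingType) (c : nat) (x : 'I_c -> A) :
    noetherian A -> (forall a, mpow x 1 a -> exists b, b * (1 - a) = 1) ->
  forall a, (forall k, mpow x k a) -> a = 0.
Proof.
move=> noeA jac a ha; apply: contrapT => a0.
have [||L [hL _ Lna Lmax]] := @maximal_avoiding A (fun b => b = 0) (fun b => b = a).
- exact: zero_is_ideal.
- by move=> _ -> /esym.

have Lxa i : L (x i * a).
  apply: contrapT => /Lmax[l [d [Ll e]]].
  have [|v hv] := jac (x i * d); first by apply: mpow_gen.
  apply: (Lna a) => //.
  rewrite -[a]mul1r -hv -mulrA; apply: idealMl => //.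
  by rewrite mulrBl mul1r -[X in X - _]e; have -> : l + d * (x i * a) - x i * d * a = l by ring.
have /all_sig[m hm] i : {m | L (x i ^+ m)}.
  apply: cid; pose I n b := L (x i ^+ n * b).
  have hI n : is_ideal (I n).
    rewrite /I; split=> [|b b' h h'|b b' h]; first by rewrite mulr0; apply: ideal0.
      by rewrite mulrDr; apply: idealD.
    by rewrite mulrCA; apply: idealMl.
  have [|N hN] := @noetherian_chain A I noeA hI.
    move=> n n' b le_n h; rewrite /I -(subnK le_n) exprD -mulrA.
    by apply: idealMl.
  exists N; apply: contrapT => /Lmax[l [d [Ll e]]].
  apply: (Lna a) => //; rewrite -e; apply: idealD => //.
  have /hN : I N.+1 d; last by rewrite /I mulrC.
  rewrite /I exprS.
  have -> : x i * x i ^+ N * d = x i * a - x i * l by rewrite -e; ring.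
  by apply: idealB => //; apply: idealMl.
have [k hk] := mpow_nilp hL hm.
by apply: (Lna a) => //; apply: hk.
Qed.

(** * Extension of derivations *)

Record derivation (A : comNzRingType) (D : A -> A) : Prop := IsDerivation {
  derD : forall a b, D (a + b) = D a + D b;
  derM : forall a b, D (a * b) = D a * b + a * D b }.

Section Derivations.
Variables (A : comNzRingType) (D : A -> A) (hD : derivation D).

Lemma der0 : D 0 = 0.
Proof. by apply: (addrI (D 0)); rewrite -(derD hD) !addr0. Qed.

Lemma der1 : D 1 = 0.
Proof.
have := derM hD 1 1; rewrite !mulr1 mul1r => e.
by apply: (addrI (D 1)); rewrite -e addr0.
Qed.

Lemma derN a : D (- a) = - D a.
Proof. by apply: (addrI (D a)); rewrite -(derD hD) !subrr der0. Qed.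

Lemma der_sum (T : Type) (r : seq T) (P : pred T) (F : T -> A) :
  D (\sum_(i <- r | P i) F i) = \sum_(i <- r | P i) D (F i).
Proof. exact: (big_morph D (derD hD) der0). Qed.

Lemma derXS a n : D (a ^+ n.+1) = n.+1%:R * a ^+ n * D a.
Proof.
elim: n => [|n IH]; first by rewrite !expr1 expr0 !mul1r.
by rewrite exprS (derM hD) IH -[in RHS]natr1 !exprS; ring.
Qed.

Lemma der_horner (p : {poly A}) a :
  D p.[a] = \sum_(i < size p) D p`_i * a ^+ i + p^`().[a] * D a.
Proof.
rewrite horner_coef der_sum.
have -> : p^`().[a] = \sum_(i < size p) p`_i * (a ^+ i.-1 *+ i).
  rewrite -[in LHS](coefK p) poly_def linear_sum horner_sum /=.
  by apply: eq_bigr => i _; rewrite derivZ derivXn hornerZ hornerMn hornerXn.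
rewrite mulr_suml -big_split /=; apply: eq_bigr => i _.
rewrite (derM hD); congr (_ + _).
case: (nat_of_ord i) => [|j]; first by rewrite expr0 der1 mulr0n !mulr0 mul0r.
by rewrite derXS -mulr_natl; ring.
Qed.

End Derivations.

Lemma size_deriv_torsion_free (A : nzRingType) (p : {poly A}) :
    (forall n (a : A), a *+ n.+1 = 0 -> a = 0) ->
  size p^`() = (size p).-1.
Proof.
move=> tf; have [le1|lt1] := leqP (size p) 1.
  by rewrite [p]size1_polyC // derivC size_poly0 size_polyC; case: (_ != 0).
have e : (size p).-2.+1 = (size p).-1 by case: (size p) lt1 => [|[]].
apply: size_poly_eq; rewrite e; apply/eqP => /=; rewrite -e => /tf; rewrite e => /eqP.
by apply/negP; rewrite -lead_coefE lead_coef_eq0 -size_poly_gt0 ltnW.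
Qed.

Section DerivationExtension.
Variables (F : fieldType) (charF : [pchar F] =i pred0).
Implicit Types (G : F -> F -> Prop) (p q : {poly F}).

(* A derivation defined on a subring of F, given by its graph, which is a
   subring of the dual numbers over F. *)
Record partial_der G : Prop := PartialDer {
  pd1 : G 1 0;
  pdB : forall a a' b b', G a a' -> G b b' -> G (a - b) (a' - b');
  pdM : forall a a' b b', G a a' -> G b b' -> G (a * b) (a' * b + a * b');
  pd_fun : forall y, G 0 y -> y = 0 }.

Definition poly_graph G p q := forall i, G p`_i q`_i.

(** The extension of [G] to the ring generated by its domain and [g], with value [v] at [g]: p(g) is
    sent to p^D(g) + v p'(g), where p^D has the differentiated coefficients. *)
Definition adjoin G g v (z z' : F) :=
  exists p q, [/\ poly_graph G p q, z = p.[g] & z' = q.[g] + v * p^`().[g]].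

Lemma char0_torsion_free n (a : F) : a *+ n.+1 = 0 -> a = 0.
Proof.
have /pcharf0P ch := charF.
by move=> /eqP; rewrite -mulr_natr mulf_eq0 ch orbF => /eqP.
Qed.

Let size_deriv p : size p^`() = (size p).-1.
Proof. exact: size_deriv_torsion_free char0_torsion_free. Qed.

Section PartialDer.
Variables (G : F -> F -> Prop) (hG : partial_der G).

Lemma pd0 : G 0 0.
Proof. by have := pdB hG (pd1 hG) (pd1 hG); rewrite !subrr. Qed.

Lemma pdD a a' b b' : G a a' -> G b b' -> G (a + b) (a' + b').
Proof.
by move=> h h'; have := pdB hG h (pdB hG pd0 h'); rewrite !sub0r !opprK.
Qed.

Lemma pd_sum (T : Type) (r : seq T) (P : pred T) (f f' : T -> F) :
  (forall i, P i -> G (f i) (f' i)) ->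
  G (\sum_(i <- r | P i) f i) (\sum_(i <- r | P i) f' i).
Proof.
by move=> h; elim/big_ind2: _ => // *; [exact: pd0|exact: pdD].
Qed.

Lemma pdMn a a' n : G a a' -> G (a *+ n) (a' *+ n).
Proof.
by move=> h; elim: n => [|n IH]; rewrite ?mulr0n ?mulrS; [apply: pd0|apply: pdD].
Qed.

Lemma poly_graphC a a' : G a a' -> poly_graph G a%:P a'%:P.
Proof. by move=> h i; rewrite !coefC; case: eqP => // _; apply: pd0. Qed.

Lemma poly_graphB p q p' q' : poly_graph G p q -> poly_graph G p' q' ->
  poly_graph G (p - p') (q - q').
Proof. by move=> h h' i; rewrite !coefB; apply: pdB. Qed.

Lemma poly_graphM p q p' q' : poly_graph G p q -> poly_graph G p' q' ->
  poly_graph G (p * p') (q * p' + p * q').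
Proof.
move=> h h' i; rewrite coefD !coefM -big_split /=; apply: pd_sum => j _.
by apply: pdM.
Qed.

Lemma poly_graphXn n : poly_graph G 'X^n 0.
Proof.
by move=> i; rewrite coefXn coef0; case: (i == n); [apply: pd1|apply: pd0].
Qed.

Lemma adjoin_id g v : adjoin G g v g v.
Proof.
exists 'X, 0; split; first exact: (poly_graphXn 1).
  by rewrite hornerX.
by rewrite horner0 derivX hornerC mulr1 add0r.
Qed.

Lemma adjoin_sub g v a a' : G a a' -> adjoin G g v a a'.
Proof.
move=> h; exists a%:P, a'%:P; rewrite derivC !hornerC mulr0 addr0; split=> //.
exact: poly_graphC.
Qed.

Lemma adjoin_partial_der g v :
    (forall p q, poly_graph G p q -> p.[g] = 0 -> q.[g] + v * p^`().[g] = 0) ->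
  partial_der (adjoin G g v).
Proof.
move=> hv; split.
- by apply: adjoin_sub; apply: pd1.
- move=> _ _ _ _ [p [q [h -> ->]]] [p' [q' [h' -> ->]]].
  exists (p - p'), (q - q'); split; first exact: poly_graphB.
    by rewrite hornerD hornerN.
  by rewrite derivB !hornerD !hornerN; ring.
- move=> _ _ _ _ [p [q [h -> ->]]] [p' [q' [h' -> ->]]].
  exists (p * p'), (q * p' + p * q'); split; first exact: poly_graphM.
    by rewrite hornerM.
  by rewrite derivM !hornerD !hornerM; ring.
- by move=> y [p [q [h /esym p0 ->]]]; apply: hv.
Qed.

Lemma adjoin_transcendental g v :
    (forall p, (forall i, exists y, G p`_i y) -> p.[g] = 0 -> p = 0) ->
  partial_der (adjoin G g v).
Proof.
move=> tr; apply: adjoin_partial_der => p q h pg0.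
have p0 : p = 0 by apply: tr => // i; exists q`_i.
have -> : q = 0.
  by apply/polyP => i; rewrite coef0; apply: (pd_fun hG); have := h i; rewrite p0 coef0.
by rewrite p0 derivC !horner0 mulr0 addr0.
Qed.

(** Let p have least degree among the nonzero polynomials over the domain of [G] that vanish at [g].
    Then p'(g) is nonzero by minimality in characteristic zero, and v = - p^D(g) / p'(g) is forced.
    The other polynomials vanishing at [g] are reduced to p by pseudo-division, the domain of [G]
    being only a ring. *)
Lemma adjoin_algebraic g :
    ~ (forall p, (forall i, exists y, G p`_i y) -> p.[g] = 0 -> p = 0) ->
  exists v, partial_der (adjoin G g v).
Proof.
move=> /existsNP[p0 /not_implyP[Gp0 /not_implyP[p0g p0n0]]].
pose Q n := `[< exists p, [/\ p != 0, (forall i, exists y, G p`_i y), p.[g] = 0 & size p = n] >].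
have exQ : exists n, Q n.
  by exists (size p0); apply/asboolP; exists p0; split=> //; apply/eqP.
case: (ex_minnP exQ) => n /asboolP[p [pn0 Gp pg sp]] nmin {p0 Gp0 p0g p0n0 exQ}.
have small p1 : (forall i, exists y, G p1`_i y) -> p1.[g] = 0 ->
    (size p1 < n)%N -> p1 = 0.
  move=> Gp1 p1g; rewrite ltnNge => h; apply: contrapT => /eqP p1n0.
  by move/negP: h; apply; apply: nmin; apply/asboolP; exists p1.
have /choice[y hy] := Gp.
have pq : exists q, poly_graph G p q.
  exists (\poly_(i < size p) y i) => i; rewrite coef_poly; case: ltnP => // le_i.
  by rewrite nth_default //; apply: pd0.
have [q {y hy}hq] := pq.
have p'g : p^`().[g] != 0.
  apply/eqP => /small h.
  have : p^`() = 0.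
    apply: h; last by rewrite -sp size_deriv ltn_predL size_poly_gt0.
    move=> i; rewrite coef_deriv; have [z hz] := Gp i.+1; exists (z *+ i.+1).
    exact: pdMn.
  move/(congr1 (fun p => size (p : {poly F}))); rewrite size_deriv size_poly0.
  move=> s1; have /size1_polyC e : (size p <= 1)%N by case: (size p) s1 => [|[]].
  by move: pg pn0; rewrite e hornerC => ->; rewrite eqxx.
exists (- q.[g] / p^`().[g]); apply: adjoin_partial_der; set v := - _ / _.
have pv : q.[g] + v * p^`().[g] = 0 by rewrite /v divfK ?subrr // addrC addNr.
move=> p1; have [m] := ubnP (size p1); elim: m p1 => // m IH p1 lt_m q1 h1 p1g.
have [/small p10|le_n] := ltnP (size p1) n.
  have {}p10 : p1 = 0 by apply: p10 => // i; exists q1`_i.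
  have -> : q1 = 0.
    apply/polyP => i; rewrite coef0; apply: (pd_fun hG).
    by have := h1 i; rewrite p10 coef0.
  by rewrite p10 derivC !horner0 mulr0 addr0.
(* One step of pseudo-division: a p1 - c X^k p is shorter than p1 and vanishes at [g]. The values a'
   and c' of the leading coefficients are carried along, so that the result is again a pair of the
   graph. *)
pose k := (size p1 - size p)%N.
pose a := lead_coef p; pose a' := q`_(size p).-1.
pose c := lead_coef p1; pose c' := q1`_(size p1).-1.
have hA := poly_graphM (poly_graphC (hq (size p).-1)) h1.
have hB := poly_graphM (poly_graphM (poly_graphC (h1 (size p1).-1)) (poly_graphXn k)) hq.
have hAB := poly_graphB hA hB.
have an0 : a != 0 by rewrite lead_coef_eq0.
have p1n0 : p1 != 0 by rewrite -size_poly_gt0 (leq_trans _ le_n) // -sp size_poly_gt0.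
have {IH} := IH _ _ _ hAB _.
rewrite -/(lead_coef p) -/(lead_coef p1) -/a -/c -/a' -/c'.
set p2 := _ - _; set q2 := _ - _ => IH.
have s2 : (size p2 < m)%N.
  have s1 : (size p1).-1.+1 = size p1 by rewrite prednK // size_poly_gt0.
  apply: (@leq_trans (size p1)); last by rewrite -ltnS.
  rewrite -s1 ltnS; apply/leq_sizeP => j le_j.
  rewrite coefB coefCM -mulrA coefCM coefXnM.
  have p_gt0 : (0 < size p)%N by rewrite size_poly_gt0.
  have /negbTE -> : ~~ (j < k)%N by rewrite -leqNgt /k; lia.
  have [lt_j|{le_j}ge_j] := ltnP j (size p1).
    have -> : j = (size p1).-1 by lia.
    have -> : ((size p1).-1 - k = (size p).-1)%N by rewrite /k; lia.
    by rewrite -!lead_coefE mulrC subrr.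
  rewrite !nth_default ?(mulr0, subr0) //.
  by apply: leq_trans (leq_sub2r k ge_j); rewrite subKn // sp.
have p2g : p2.[g] = 0 by rewrite /p2 !hornerE pg p1g !mulr0 subrr.
have {IH} := IH s2 p2g.
rewrite /p2 /q2 derivB !derivM derivC !(hornerD, hornerN, hornerM) derivC !hornerC p1g pg => e.
have : a * (q1.[g] + v * p1^`().[g]) - c * 'X^k.[g] * (q.[g] + v * p^`().[g]) = 0.
  rewrite -[RHS]e. ring.
by rewrite pv mulr0 subr0 => /eqP; rewrite mulf_eq0 (negbTE an0) => /eqP.
Qed.

End PartialDer.

(** Zorn's lemma on graphs: a maximal one is total, since any missing element could be adjoined, be
    it transcendental or algebraic over the domain. *)
Lemma partial_der_extends G : partial_der G ->
  exists D, derivation D /\ forall a a', G a a' -> D a = a'.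
Proof.
move=> hG.
pose P (X : set (F * F)) := (forall z, ~ X z) \/
   partial_der (fun a a' => X (a, a')) /\ forall a a', G a a' -> X (a, a').
have [X XP Xtot|X [PX Xmax]] := @Zorn_bigcup _ P.
  have [[Y XY [y Yy]]|noY] := pselect (exists2 Y, X Y & exists z, Y z); last first.
    by left=> z [Y XY Yz]; apply: noY; exists Y => //; exists z.
  have good Z z : X Z -> Z z ->
      partial_der (fun a a' => Z (a, a')) /\ forall a a', G a a' -> Z (a, a').
    by move=> XZ Zz; have [h|//] := XP _ XZ; case: (h z).
  have join z t Z T : X Z -> Z z -> X T -> T t -> exists2 U, X U & U z /\ U t.
    move=> XZ Zz XT Tt; have [h|h] := Xtot _ _ XZ XT.
      by exists T => //; split=> //; apply: h.
    by exists Z => //; split=> //; apply: h.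
  right; split; last first.
    by move=> a a' Ga; exists Y => //; have [_] := good _ _ XY Yy; apply.
  have [pY _] := good _ _ XY Yy; split.
  - by exists Y => //; apply: (pd1 pY).
  - move=> a a' b b' [Z XZ Za] [T XT Tb]; have [U XU [Ua Ub]] := join _ _ _ _ XZ Za XT Tb.
    by have [pU _] := good _ _ XU Ua; exists U => //; apply: (pdB pU).
  - move=> a a' b b' [Z XZ Za] [T XT Tb]; have [U XU [Ua Ub]] := join _ _ _ _ XZ Za XT Tb.
    by have [pU _] := good _ _ XU Ua; exists U => //; apply: (pdM pU).
  - by move=> a' [Z XZ Za]; have [pZ _] := good _ _ XZ Za; apply: (pd_fun pZ).
have {PX}[X0|[pX GX]] := PX.
  case: (Xmax (fun z : F * F => G z.1 z.2)); last by right; split=> //; case: hG.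
  split; first by move=> z /X0.
  by move=> /(_ (1, 0) (pd1 hG)); apply: X0.
have tot a : exists a', X (a, a').
  have [v hv] : exists v, partial_der (adjoin (fun a a' => X (a, a')) a v).
    have [tr|alg] := pselect (forall p,
        (forall i, exists y, X (p`_i, y)) -> p.[a] = 0 -> p = 0).
      by exists 0; apply: (adjoin_transcendental pX _ tr).
    exact: adjoin_algebraic pX _ alg.
  exists v; apply: contrapT => Xav.
  apply: (Xmax (fun z : F * F => adjoin (fun a a' => X (a, a')) a v z.1 z.2)).
    split; first by move=> [b b'] Xb; apply: (adjoin_sub pX _ _ Xb).
    by move=> /(_ (a, v)) h; apply: Xav; apply: h; apply: (adjoin_id pX).
  by right; split=> // b b' /GX Xb; apply: (adjoin_sub pX _ _ Xb).
have /choice[D hD] := tot.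
have uniq a a' : X (a, a') -> D a = a'.
  move=> h; apply/eqP; rewrite -subr_eq0; apply/eqP; apply: (pd_fun pX).
  by rewrite -(subrr a); apply: (pdB pX).
exists D; split; last by move=> a a' /GX/uniq.
split=> a b; apply: uniq; first exact: (pdD pX).
exact: (pdM pX).
Qed.

End DerivationExtension.

(** * Algebraic independence *)

Section AlgebraicIndependence.
Variables (K : fieldType) (R : comAlgType K).
Implicit Types (ws ys : seq R) (P Q : R -> Prop) (p q : {poly R}).

(* The subalgebra K[ws]. *)
Fixpoint adj ws (r : R) : Prop :=
  if ws is w :: ws' then exists p, (forall i, adj ws' p`_i) /\ r = p.[w]
  else exists c : K, r = c%:A.

(* Algebraic independence over K of the elements of ws modulo P. *)
Fixpoint aind P ws : Prop :=
  if ws is w :: ws' then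
    aind P ws' /\ forall p, (forall i, adj ws' p`_i) -> P p.[w] -> p = 0
  else forall c : K, P c%:A -> c = 0.

Lemma adjW w ws r : adj ws 0 -> adj ws r -> adj (w :: ws) r.
Proof.
move=> h0 h; exists r%:P; rewrite hornerC; split=> // i.
by rewrite coefC; case: (i == 0%N).
Qed.

Lemma adj_alg ws c : adj ws c%:A.
Proof.
elim: ws c => [|w ws IH] c; first by exists c.
by apply: adjW => //; rewrite -(scale0r (1 : R)).
Qed.

Lemma adj0 ws : adj ws 0.
Proof. by rewrite -(scale0r (1 : R)); apply: adj_alg. Qed.

Lemma adj1 ws : adj ws 1.
Proof. by rewrite -(scale1r (1 : R)); apply: adj_alg. Qed.

Lemma adjDM ws : (forall a b, adj ws a -> adj ws b -> adj ws (a + b)) /\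
  (forall a b, adj ws a -> adj ws b -> adj ws (a * b)).
Proof.
elim: ws => [|w ws [IHD IHM]]; split.
- by move=> _ _ [a ->] [b ->]; exists (a + b); rewrite scalerDl.
- by move=> _ _ [a ->] [b ->]; exists (a * b); rewrite -scalerAl mul1r scalerA.
- move=> _ _ [p [hp ->]] [q [hq ->]]; exists (p + q); rewrite hornerD; split=> // i.
  by rewrite coefD; apply: IHD (hp i) (hq i).
- move=> _ _ [p [hp ->]] [q [hq ->]]; exists (p * q); rewrite hornerM; split=> // i.
  rewrite coefM; elim/big_ind: _ => // [|j _]; first exact: adj0.
  exact: IHM (hp j) (hq (i - j)%N).
Qed.

Lemma adjD ws a b : adj ws a -> adj ws b -> adj ws (a + b).
Proof. exact: (adjDM ws).1. Qed.

Lemma adjM ws a b : adj ws a -> adj ws b -> adj ws (a * b).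
Proof. exact: (adjDM ws).2. Qed.

Lemma adjMn ws a n : adj ws a -> adj ws (a *+ n).
Proof.
by move=> h; elim: n => [|n IH]; rewrite ?mulr0n ?mulrS; [apply: adj0|apply: adjD].
Qed.

Lemma adj_head w ws : adj (w :: ws) w.
Proof.
exists 'X; rewrite hornerX; split=> // i; rewrite coefX.
by case: (i == 1%N); [apply: adj1|apply: adj0].
Qed.

Lemma aind_nil P : is_ideal P -> ~ P 1 -> aind P [::].
Proof.
move=> hP P1 c Pc; apply: contrapT => /eqP c0; apply: P1.
have -> : 1 = c^-1%:A * c%:A :> R by rewrite -scalerAl mul1r scalerA mulVf ?scale1r.
exact: idealMl.
Qed.

Lemma aind_inter P ws r : aind P ws -> adj ws r -> P r -> r = 0.
Proof.
case: ws => [h [c ->] /h ->|w ws [_ h] [p [hp ->]] /h ->//]; last by rewrite horner0.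
by rewrite scale0r.
Qed.

Lemma aindS P Q ws : (forall r, P r -> Q r) -> aind Q ws -> aind P ws.
Proof.
move=> PQ; elim: ws => [h c /PQ/h//|w ws IH [/IH h hw]]; split=> // p hp /PQ.
exact: hw.
Qed.

Definition prime_ideal P : Prop :=
  is_ideal P /\ forall a b, P (a * b) -> P a \/ P b.

(** Modulo Q a relation for [w] reduces to its constant term, which therefore vanishes. Then [w],
    not being in the prime P, can be cancelled, and the degree drops. *)
Lemma aind_cons P Q ws w : prime_ideal P -> is_ideal Q ->
    (forall r, P r -> Q r) -> aind Q ws -> Q w -> ~ P w ->
  aind P (w :: ws).
Proof.
move=> [hP pP] hQ PQ hws Qw Pw; split; first exact: aindS hws.
elim/poly_ind => [//|p c IH] hp Ppw.
have c0 : c = 0.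
  apply: (aind_inter hws); first by have := hp 0%N; rewrite coefD coefMX coefC add0r.
  have := PQ _ Ppw; rewrite hornerMXaddC => h.
  have -> : c = (p.[w] * w + c) - p.[w] * w by ring.
  by apply: idealB => //; apply: idealMl.
rewrite c0 addr0 in Ppw hp *; rewrite IH ?mul0r // => [i|].
  by have := hp i.+1; rewrite coefMX.
by move: Ppw; rewrite hornerMX => /pP[].
Qed.

(** Dimension is at most transcendence degree: each strict inclusion of primes contributes an
    element of the larger one outside the smaller one. *)
Lemma aind_chain d (P : nat -> R -> Prop) ys :
    (forall i, (i < d)%N -> [/\ prime_ideal (P i), forall r, P i r -> P i.+1 r &
       exists2 x, P i.+1 x & ~ P i x]) -> is_ideal (P d) -> aind (P d) ys ->
  exists ws, size ws = (d + size ys)%N /\ aind (P 0%N) ws.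
Proof.
elim: d ys => [|d IH] ys hP hd hys; first by exists ys.
have [pP PP [x x1 x0]] := hP d (ltnSn d).
have [|ws [sz hws]] := IH (x :: ys) (fun i hi => hP i (ltnW hi)) pP.1.
  exact: aind_cons PP hys x1 x0.
by exists ws; rewrite sz /= addnS.
Qed.

Hypothesis charK : [pchar K] =i pred0.

Lemma alg_torsion_free n (a : R) : a *+ n.+1 = 0 -> a = 0.
Proof.
have /pcharf0P ch := charK; rewrite -scaler_nat => e.
have n0 : n.+1%:R != 0 :> K by rewrite ch.
by rewrite -[a]scale1r -(mulVf n0) -scalerA e scaler0.
Qed.

(** A transcendence basis [ys] modulo P. An element that cannot be added satisfies a relation over
    K[ys] of least degree, and in characteristic zero the derivative of that relation does not
    vanish modulo P. *)
Lemma aind_maximal P (s : seq R) : is_ideal P -> ~ P 1 ->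
  exists ys, aind P ys /\ forall g, g \in s -> exists p,
    [/\ forall i, adj ys p`_i, P p.[g] & ~ P p^`().[g]].
Proof.
move=> hP P1; elim: s => [|g s [ys [hys hs]]].
  by exists [::]; split=> //; apply: aind_nil.
have [h|h] := pselect (aind P (g :: ys)).
  exists (g :: ys); split=> // g'; rewrite inE => /orP[/eqP ->|/hs].
    exists ('X - g%:P); split=> [i||].
    - rewrite coefB coefX coefC -[X in _ - X]mul1r -mulNr; apply: adjD.
        by case: (i == 1%N); [apply: adj1|apply: adj0].
      apply: adjM; first by rewrite -scaleN1r; apply: adj_alg.
      by case: (i == 0%N); [apply: adj_head|apply: adj0].
    - by rewrite hornerXsubC subrr; apply: ideal0.
    - by rewrite derivXsubC hornerC.
  move=> [p [hp Pp Pp']]; exists p; split=> // i.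
  by apply: adjW (hp i); apply: adj0.
exists ys; split=> // g'; rewrite inE => /orP[/eqP {g'}->|/hs//].
have {h}/existsNP[p0 /not_implyP[hp0 /not_implyP[Pp0 p00]]] :
    ~ forall p, (forall i, adj ys p`_i) -> P p.[g] -> p = 0.
  by move=> h'; apply: h.
pose T n := `[< exists p, [/\ p != 0, forall i, adj ys p`_i, P p.[g] & size p = n] >].
have exT : exists n, T n.
  by exists (size p0); apply/asboolP; exists p0; split=> //; apply/eqP.
case: (ex_minnP exT) => n /asboolP[p [pn0 hp Pp sp]] nmin {p0 hp0 Pp0 p00 exT}.
exists p; split=> // Pp'.
have s' : size p^`() = (size p).-1.
  exact: size_deriv_torsion_free alg_torsion_free.
have p'0 : p^`() = 0.
  apply: contrapT => /eqP p'n0.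
  have : (n <= size p^`())%N.
    apply: nmin; apply/asboolP; exists p^`(); split=> // i.
    by rewrite coef_deriv; apply: adjMn.
  by rewrite s' -sp leqNgt prednK ?leqnn // size_poly_gt0.
move: s'; rewrite p'0 size_poly0 => s1.
have /size1_polyC e : (size p <= 1)%N by case: (size p) s1 => [|[]].
move: Pp pn0; rewrite e hornerC => /(aind_inter hys (hp 0%N)) ->.
by rewrite eqxx.
Qed.

(** The entries of [ws] are adjoined one after another with values from [vs]. Keeping the domain of
    the graph inside phi(K[ws]) makes the next entry transcendental over it. *)
Lemma aind_partial_der (F : fieldType) (phi : {rmorphism R -> F}) ws (vs : seq F) :
    aind (fun r => phi r = 0) ws ->
  exists G : F -> F -> Prop, [/\ partial_der G,
    forall a a', G a a' -> exists2 r, adj ws r & a = phi r,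
    forall c : K, G (phi c%:A) 0 &
    forall i, (i < size ws)%N -> G (phi (nth 0 ws i)) (nth 0 vs i)].
Proof.
elim: ws vs => [|w ws IH] vs.
  move=> h; exists (fun a a' => (exists c : K, a = phi c%:A) /\ a' = 0).
  split=> // [|_ _ [[c ->] _]|c]; last by split=> //; exists c.
    split=> [|_ _ _ _ [[c ->] ->] [[c' ->] ->]|_ _ _ _ [[c ->] ->] [[c' ->] ->]|y []//].
    - by split=> //; exists 1; rewrite scale1r rmorph1.
    - by split; [exists (c - c'); rewrite scalerBl rmorphB|rewrite subrr].
    - split; last by rewrite mulr0 mul0r addr0.
      by exists (c * c'); rewrite -rmorphM -scalerAl mul1r scalerA.
  by exists c%:A => //; exists c.
move=> [hws hw]; have [G [pG domG constG Gws]] := IH (behead vs) hws.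
have lift (p : {poly F}) : (forall i, exists y, G p`_i y) ->
    exists2 q : {poly R}, (forall i, adj ws q`_i) & p = map_poly phi q.
  move=> hp; have /choice[u hu] i : exists r, adj ws r /\ p`_i = phi r.
    by have [y /domG[r ? ?]] := hp i; exists r.
  exists (\poly_(i < size p) u i) => [i|].
    rewrite coef_poly; case: ifP => _; last exact: adj0.
    by have [] := hu i.
  apply/polyP => i; rewrite coef_map coef_poly; case: ltnP => h /=.
    by have [] := hu i.
  by rewrite raddf0 nth_default.
exists (adjoin G (phi w) (nth 0 vs 0)); split.
- apply: adjoin_transcendental => // p /lift[q hq ->].
  by rewrite horner_map => /hw -> //; rewrite rmorph0.
- move=> _ _ [p [q [hpq -> _]]].
  have [|p' hp' ->] := lift p; first by move=> i; exists q`_i.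
  by exists p'.[w]; [exists p'|rewrite horner_map].
- by move=> c; apply: adjoin_sub.
- move=> [|i] /= hi; first exact: adjoin_id.
  by apply: adjoin_sub => //; have := Gws i hi; rewrite nth_behead.
Qed.

(** With [vs] a unit vector this gives a partial derivative with respect to one entry of [ws]. *)
Lemma dual_derivation (F : fieldType) (phi : {rmorphism R -> F}) ws (vs : seq F) :
    [pchar F] =i pred0 -> aind (fun r => phi r = 0) ws ->
  exists D : F -> F, [/\ derivation D, forall c : K, D (phi c%:A) = 0 &
    forall i, (i < size ws)%N -> D (phi (nth 0 ws i)) = nth 0 vs i].
Proof.
move=> charF /aind_partial_der-/(_ vs)[G [pG _ Gc Gws]].
have [D [hD DG]] := partial_der_extends charF pG.
by exists D; split=> // [c|i hi]; apply: DG; [exact: Gc|exact: Gws].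
Qed.

End AlgebraicIndependence.

(** * Local rings of R at primes *)

Section LocalizationAtPrime.
Variables (R : comNzRingType) (P : prime_idealr R).
Local Notation S := (loc_at P).
Local Notation iota := (loc_inj (compl_prime P) : R -> S).

Lemma loc_at_unit r : r \notin P -> iota r \is a GRing.unit.
Proof. by move=> h; apply: loc_inj_unit; rewrite inE. Qed.

Lemma loc_at_frac (a : S) : exists r s, s \notin P /\ a = iota r / iota s.
Proof.
exists (numer a), (dval (denom a)).
by rewrite -FracE FracK; split=> //; have := dvalP (denom a); rewrite inE.
Qed.

Lemma loc_inj_eq r s : iota r = iota s -> exists2 u, u \notin P & u * r = u * s.
Proof. by move=> /FracP[u]; rewrite inE !mulr1 => ? ?; exists u. Qed.

Lemma loc_inj_eq0 r : iota r = 0 -> exists2 u, u \notin P & u * r = 0.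
Proof.
move=> e; have [|u Pu] := @loc_inj_eq r 0; first by rewrite e rmorph0.
by rewrite mulr0; exists u.
Qed.

Definition loc_nonunit (a : S) :=
  exists r s, [/\ r \in P, s \notin P & a * iota s = iota r].

Lemma denom_neqM s t : s \notin P -> t \notin P -> s * t \notin P.
Proof. by rewrite prime_idealrM negb_or => -> ->. Qed.

Lemma loc_nonunit_inj r : loc_nonunit (iota r) <-> r \in P.
Proof.
split=> [[y [s [Py Ps]]]|Pr]; last first.
  by exists r, 1; rewrite rmorph1 mulr1 idealr1; split.
rewrite -rmorphM => /loc_inj_eq[u Pu e].
have : u * (r * s) \in P by rewrite e idealMr.
by rewrite !prime_idealrM (negbTE Pu) (negbTE Ps) orbF.
Qed.

Lemma loc_nonunit_ideal : is_ideal loc_nonunit.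
Proof.
split.
- by exists 0, 1; rewrite idealr0 idealr1 mul0r rmorph0; split.
- move=> a b [r [s [Pr Ps e]]] [r' [s' [Pr' Ps' e']]].
  exists (r * s' + r' * s), (s * s'); split.
  + by rewrite rpredD // mulrC idealMr.
  + exact: denom_neqM.
  + by rewrite rmorphD !rmorphM /= -e -e'; ring.
- move=> a b [r [s [Pr Ps e]]]; have [y [t [Pt ->]]] := loc_at_frac a.
  exists (y * r), (t * s); split; [exact: idealMr|exact: denom_neqM|].
  rewrite !rmorphM /= -e; apply: (mulrI (loc_at_unit Pt)).
  rewrite [RHS]mulrC -[in RHS](divrK (loc_at_unit Pt) (iota y)); ring.
Qed.

Lemma loc_nonunitP a : loc_nonunit a <-> a \isn't a GRing.unit.
Proof.
split=> [ha|Ua].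
  apply/negP => Ua; have : loc_nonunit (iota 1).
    by rewrite rmorph1 -(mulVr Ua); apply: idealMl => //; apply: loc_nonunit_ideal.
  by move/loc_nonunit_inj; rewrite idealr1.
have [r [s [Ps e]]] := loc_at_frac a; exists r, s.
rewrite e divrK ?loc_at_unit //; split=> //.
apply: contraNT Ua => Pr.
by rewrite e unitrM unitrV !loc_at_unit.
Qed.

Lemma bundle_loc_nonunit :
  exists N : prime_idealr S, forall a, a \in N <-> a \isn't a GRing.unit.
Proof.
have [||a b|N hN] := @bundle_prime S (fun a => a \isn't a GRing.unit).
- have [h0 hD hM] := loc_nonunit_ideal; split.
  + exact/loc_nonunitP.
  + by move=> a b /loc_nonunitP ha /loc_nonunitP hb; apply/loc_nonunitP; apply: hD.
  + by move=> a b /loc_nonunitP hb; apply/loc_nonunitP; apply: hM.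
- by rewrite unitr1.
- by rewrite unitrM negb_and => /orP[]; [left|right].
by exists N.
Qed.

Lemma local_ring_unit (M : idealr S) : local_ring M ->
  forall a, a \in M <-> a \isn't a GRing.unit.
Proof.
move=> [_ uniqM]; have [N hN] := bundle_loc_nonunit.
have maxN : maximal_ideal (N : idealr S).
  move=> J NJ a Ja; apply/hN/negP => Ua.
  by have := idealr1 J; rewrite -(mulVr Ua) idealMr.
by move=> a; rewrite -hN; rewrite (uniqM _ maxN a).
Qed.

Lemma prime_loc_unit (Q : prime_idealr S) a : a \in Q -> a \isn't a GRing.unit.
Proof.
by move=> Qa; apply/negP => Ua; have := idealr1 Q; rewrite -(mulVr Ua) idealMr.
Qed.

End LocalizationAtPrime.

Lemma fin_gen_ind (K : fieldType) (R : comAlgType K) n (g : 'I_n -> R)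
    (gen : forall A : subalgClosed R, (forall i, g i \in A) -> forall r, r \in A)
    (Pr : R -> Prop) :
    (forall c : K, Pr c%:A) -> (forall a b, Pr a -> Pr b -> Pr (a + b)) ->
    (forall a b, Pr a -> Pr b -> Pr (a * b)) -> (forall i, Pr (g i)) ->
  forall r, Pr r.
Proof.
move=> PC PD PM Pg r; pose B : R -> bool := fun a => `[< Pr a >].
have hB : subalg_closed B.
  split=> [|c a b /asboolP ha /asboolP hb|a b /asboolP ha /asboolP hb]; apply/asboolP.
  - by rewrite -(scale1r 1).
  - by apply: PD => //; rewrite -[a]mul1r scalerAl; apply: PM.
  - exact: PM.
pose C : subalgClosed R := HB.pack B (GRing.isSubalgClosed.Build K R B hB).
by have /asboolP := gen C (fun i => asboolT (Pg i)) r.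
Qed.

Lemma char0_morph (K : fieldType) (R : comAlgType K) (F : fieldType)
  (phi : {rmorphism R -> F}) : [pchar K] =i pred0 -> [pchar F] =i pred0.
Proof.
move=> /pcharf0P ch; apply/pcharf0P => n; have [->|n0] := eqVneq n 0%N.
  by rewrite eqxx.
apply/negbTE/eqP => e; have /negP[] := oner_neq0 F; apply/eqP.
have e1 : 1 = n%:R * ((n%:R : K)^-1)%:A :> R.
  by rewrite mulr_natl -scaler_nat scalerA mulfV ?scale1r // ch.
by rewrite -(rmorph1 phi) e1 rmorphM rmorph_nat e mul0r.
Qed.

(** * Dual derivations at a regular point *)

Section RowSpan.
Variables (S : comUnitRingType) (F : fieldType) (psi : {rmorphism S -> F}).
Variables (m : nat) (Delta : 'I_m -> F -> F).
Hypothesis derDelta : forall j, derivation (Delta j).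

(* The differential of s, read off in the derivations Delta. *)
Definition drow (s : S) : 'rV[F]_m := \row_j Delta j (psi s).

Lemma drowD a b : drow (a + b) = drow a + drow b.
Proof. by apply/rowP => j; rewrite !mxE rmorphD (derD (derDelta j)). Qed.

Lemma drowM a b : drow (a * b) = psi a *: drow b + psi b *: drow a.
Proof.
by apply/rowP => j; rewrite !mxE rmorphM (derM (derDelta j)) addrC (mulrC _ (psi b)).
Qed.

Lemma drow0 : drow 0 = 0.
Proof. by apply/rowP => j; rewrite !mxE rmorph0 der0. Qed.

(** The coefficients come from [S], not from [F]: Nakayama's lemma needs the S-module spanned by the
    rows, and it is this integrality that makes the dual derivations preserve psi(S). *)
Definition inspan q (T : 'M[F]_(q, m)) (v : 'rV[F]_m) :=
  exists a : 'rV[S]_q, v = map_mx psi a *m T.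

Lemma inspan0 q (T : 'M_(q, m)) : inspan T 0.
Proof. by exists 0; rewrite map_mx0 mul0mx. Qed.

Lemma inspanD q (T : 'M_(q, m)) u v : inspan T u -> inspan T v -> inspan T (u + v).
Proof. by move=> [a ->] [b ->]; exists (a + b); rewrite map_mxD mulmxDl. Qed.

Lemma inspanZ q (T : 'M_(q, m)) s v : inspan T v -> inspan T (psi s *: v).
Proof. by move=> [a ->]; exists (s *: a); rewrite map_mxZ scalemxAl. Qed.

Lemma inspan_row q (T : 'M_(q, m)) i : inspan T (row i T).
Proof. by exists (delta_mx 0 i); rewrite map_delta_mx rowE. Qed.

Lemma inspan_trans q q' (T : 'M_(q, m)) (T' : 'M_(q', m)) v :
  (forall i, inspan T' (row i T)) -> inspan T v -> inspan T' v.
Proof.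
move=> hT [a ->]; rewrite mulmx_sum_row.
elim/big_ind: _ => [|u v' hu hv|i _]; [exact: inspan0|exact: inspanD|].
by rewrite mxE; apply: inspanZ.
Qed.

Lemma inspan_horner q (T : 'M_(q, m)) (p : {poly S}) z :
    (forall i, inspan T (drow p`_i)) ->
  exists2 v, inspan T v & drow p.[z] = v + psi p^`().[z] *: drow z.
Proof.
elim/poly_ind: p => [|p c IH] hp.
  exists 0; first exact: inspan0.
  by rewrite horner0 derivC horner0 rmorph0 drow0 scale0r addr0.
have [|v hv e] := IH; first by move=> i; have := hp i.+1; rewrite coefD coefMX coefC addr0.
have hc : inspan T (drow c) by have := hp 0%N; rewrite coefD coefMX coefC add0r.
exists (psi z *: v + drow c); first by apply: inspanD => //; apply: inspanZ.
rewrite hornerMXaddC drowD drowM e derivMXaddC !hornerE rmorphD rmorphM.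
by rewrite !scalerDr !scalerDl scalerA; apply/rowP => j; rewrite !mxE; ring.
Qed.

Lemma inspan_frac q (T : 'M_(q, m)) a s : s \is a GRing.unit ->
  inspan T (drow (a * s)) -> inspan T (drow s) -> inspan T (drow a).
Proof.
move=> Us h hs; have -> : drow a = psi s^-1 *: (drow (a * s) + psi (- a) *: drow s).
  have ps : psi s != 0 by rewrite -unitfE rmorph_unit.
  rewrite drowM rmorphN scaleNr addrAC subrr add0r scalerA rmorphV //.
  by rewrite mulVf ?scale1r.
by apply: inspanZ; apply: inspanD => //; apply: inspanZ.
Qed.

End RowSpan.

(** * Nakayama's lemma for rows of differentials *)

Section Nakayama.
Variables (S : comUnitRingType) (N : prime_idealr S).
Hypothesis unitN : forall a, a \in N <-> a \isn't a GRing.unit.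

(** The determinant is 1 modulo [N], hence not in [N], hence a unit. *)
Lemma unitmx_sub1 n (B : 'M[S]_n) : (forall i j, B i j \in N) -> 1%:M - B \in unitmx.
Proof.
move=> hB; have [F [chi [chi0 _]]] := exists_fraction_field N.
rewrite unitmxE; apply: contraT => /unitN/chi0.
rewrite -det_map_mx map_mxB map_mx1.
have -> : map_mx chi B = 0 by apply/matrixP => i j; rewrite !mxE; apply/chi0.
by rewrite subr0 det1 => /eqP; rewrite oner_eq0.
Qed.

Lemma nakayama_rows (F : fieldType) (psi : {rmorphism S -> F}) m n q
    (DG : 'M[F]_(n, m)) (DU : 'M[F]_(q, m)) (A : 'M[S]_(n, q)) (B : 'M[S]_n) :
    (forall i j, B i j \in N) -> DG = map_mx psi A *m DU + map_mx psi B *m DG ->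
  DG = map_mx psi (invmx (1%:M - B) *m A) *m DU.
Proof.
move=> hB e; have U1 := unitmx_sub1 hB.
have e1 : map_mx psi (1%:M - B) *m DG = map_mx psi A *m DU.
  by rewrite map_mxB map_mx1 mulmxBl mul1mx {1}e addrK.
by rewrite map_mxM -mulmxA -e1 mulmxA -map_mxM mulVmx // map_mx1 mul1mx.
Qed.

End Nakayama.

Section LocalStructure.
Variables (K : fieldType) (R : comAlgType K) (charK : [pchar K] =i pred0).
Variables (n : nat) (g : 'I_n -> R).
Hypothesis gen : forall A : subalgClosed R, (forall i, g i \in A) -> forall r, r \in A.
Variable P : prime_idealr R.
Local Notation S := (loc_at P).
Local Notation iota := (loc_inj (compl_prime P) : R -> S).

Lemma inspan_adj (F : fieldType) (psi : {rmorphism S -> F}) m (Delta : 'I_m -> F -> F)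
    q (T : 'M[F]_(q, m)) (zs : seq R) r :
    (forall j, derivation (Delta j)) ->
    (forall j (c : K), Delta j (psi (iota c%:A)) = 0) ->
    (forall z, z \in zs -> inspan psi T (drow psi Delta (iota z))) ->
  adj zs r -> inspan psi T (drow psi Delta (iota r)).
Proof.
move=> hD hK; elim: zs r => [|z zs IH] r hz.
  move=> [c ->]; have -> : drow psi Delta (iota c%:A) = 0.
    by apply/rowP => j; rewrite !mxE hK.
  exact: inspan0.
move=> [p [hp ->]]; rewrite -horner_map /=.
have [i|v hv ->] := inspan_horner (psi := psi) (T := T) (p := map_poly iota p) hD (iota z).
  rewrite coef_map; apply: IH (hp i) => y hy; apply: hz.
  by rewrite inE hy orbT.
by apply: inspanD => //; apply: inspanZ; apply: hz; rewrite mem_head.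
Qed.

(* By Nakayama, the differentials of the parameters x_i and of lifts of a
   transcendence basis of the residue field span those of S. The chain of primes
   gives as many algebraically independent elements, so they form a basis, and
   the D_i are part of the dual basis. *)
Lemma local_structure : regular_local_ring S ->
  exists (c : nat) (x : 'I_c -> S) (F : fieldType) (psi : {rmorphism S -> F})
      (D : 'I_c -> F -> F),
    (forall a, mpow x 1 a <-> a \isn't a GRing.unit) /\
    (forall a, (forall k, mpow x k a) -> a = 0) /\
    (forall a, psi a = 0 -> a \isn't a GRing.unit) /\
    (forall i, derivation (D i)) /\
    (forall i (k : K), D i (psi (iota k%:A)) = 0) /\
    (forall i s, exists s', psi s' = D i (psi s)) /\
    forall i j, D i (psi (x j)) = (i == j)%:R.
Proof.
move=> [noeS [M [locM [c [[P' chP'] _] [x hx]]]]].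
have MU := local_ring_unit locM.
have [N hN] := bundle_loc_nonunit P.
have xU a : mpow x 1 a <-> a \isn't a GRing.unit.
  rewrite -MU; split=> [[b [_ ->]]|/hx[b ->]].
    by apply/hx; exists b; apply: eq_bigr => i _; rewrite mulrC.
  by exists b; split=> //; apply: eq_bigr => i _; rewrite mulrC.
have krull : forall a, (forall k, mpow x k a) -> a = 0.
  apply: krull_intersection => // a /xU Ua; exists (1 - a)^-1; rewrite mulVr //.
  apply: contraT => /hN h; have := idealr1 N.
  by rewrite -(subrK a 1) rpredD //; apply/hN.
(* The kernel of [psi] is the smallest prime of the chain; that it vanishes is shown only later, by
   Euler's formula. *)
have [F [psi [psi0 _]]] := exists_fraction_field (P' ord0).
pose phi : {rmorphism R -> F} := psi \o iota.
have charF : [pchar F] =i pred0 by apply: (char0_morph phi).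
pose Pn (i : nat) (r : R) : Prop := iota r \in P' (inord i).
have idPn i : is_ideal (Pn i).
  rewrite /Pn; split=> [|a b ha hb|a b hb].
  - by rewrite rmorph0 idealr0.
  - by rewrite rmorphD rpredD.
  - by rewrite rmorphM idealMr.
have PnP i r : Pn i r -> r \in P.
  move=> h; apply: contraT => /(loc_at_unit (P := P)) Ur.
  by have := prime_loc_unit h; rewrite Ur.
have [ys [hys galg]] : exists ys, aind (fun r => r \in P) ys /\
    forall h, h \in codom g -> exists p : {poly R},
    [/\ forall i, adj ys p`_i, p.[h] \in P & ~ p^`().[h] \in P].
  apply: aind_maximal => //; first exact: idealr_is_ideal.
  by rewrite idealr1.
have [||ws [sz_ws hws]] := @aind_chain K R c Pn ys _ (idPn c).
- move=> i lt_ic; have lt_i : ((inord i : 'I_c.+1) < (inord i.+1 : 'I_c.+1))%N.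
    by rewrite !inordK // ltnS // ltnW.
  have [PP [z z1 z0]] := chP' _ _ lt_i; split.
  + split=> // a b; rewrite /Pn rmorphM prime_idealrM.
    by case/orP; [left|right].
  + by move=> r; apply: PP.
  + have [a [s [Ps ez]]] := loc_at_frac z.
    have Us := loc_at_unit Ps.
    exists a; rewrite /Pn; first by rewrite -(divrK Us (iota a)) -ez mulrC idealMr.
    by apply/negP; apply: contra z0 => h; rewrite ez mulrC idealMr.
- by apply: aindS hys => r; apply: PnP.
have {}hws : aind (fun r => phi r = 0) ws.
  apply: aindS hws => r /psi0; rewrite /Pn.
  by have -> : inord 0 = ord0 :> 'I_c.+1 by apply/val_inj; rewrite /= inordK.
pose e := size ys.
have /choice[Delta hDelta] (j : 'I_(c + e)) : exists D : F -> F, [/\ derivation D,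
    forall k : K, D (phi k%:A) = 0 &
    forall i : 'I_(c + e), D (phi (nth 0 ws i)) = (i == j)%:R].
  have [D [hD DK Dw]] := dual_derivation (mkseq (fun i => (i == j)%:R) (c + e)) charF hws.
  by exists D; split=> // i; rewrite Dw ?sz_ws // nth_mkseq.
have derDelta j : derivation (Delta j) by have [] := hDelta j.
have DeltaK j (k : K) : Delta j (psi (iota k%:A)) = 0 by have [_ h _] := hDelta j; apply: h.
pose d := drow psi Delta.
pose DG : 'M[F]_(n, c + e) := \matrix_(k < n) d (iota (g k)).
pose DX : 'M[F]_(c, c + e) := \matrix_(k < c) d (x k).
pose DY : 'M[F]_(e, c + e) := \matrix_(k < e) d (iota (nth 0 ys k)).
pose DU : 'M[F]_(c + e) := col_mx DX DY.
have spanR r : inspan psi DG (d (iota r)).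
  move: r; apply: (fin_gen_ind gen) => [k|a b|a b|k].
  - have -> : d (iota k%:A) = 0 by apply/rowP => j; rewrite !mxE DeltaK.
    exact: inspan0.
  - by move=> ha hb; rewrite rmorphD /d drowD //; apply: inspanD.
  - move=> ha hb; rewrite rmorphM /d drowM //.
    by apply: inspanD; apply: inspanZ.
  - by have := inspan_row psi DG k; rewrite rowK.
have spanS s : inspan psi DG (d s).
  have [a [t [Pt ->]]] := loc_at_frac s; have Ut := loc_at_unit Pt.
  apply: (inspan_frac derDelta Ut); last exact: spanR.
  by rewrite divrK.
have spanX k : inspan psi DU (d (x k)).
  have := inspan_row psi DU (lshift e k).
  by rewrite rowKu rowK.
have spanY k : inspan psi DU (d (iota (nth 0 ys (k : 'I_e)))).
  have := inspan_row psi DU (rshift c k).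
  by rewrite rowKd rowK.
have spanA r : adj ys r -> inspan psi DU (d (iota r)).
  apply: inspan_adj => // y y_ys; have lt_y : (index y ys < e)%N by rewrite index_mem.
  by have := spanY (Ordinal lt_y); rewrite /= nth_index.
(* [near s] says that d s is in the span of [DU] up to N times the span of [DG]. It holds for
   nonunits, since d(x_i b) = x_i d b + b d x_i with x_i in N. *)
pose near s := exists (a : 'rV[S]_(c + e)) (b : 'rV[S]_n), (forall j, b 0 j \in N) /\
  d s = map_mx psi a *m DU + map_mx psi b *m DG.
have nearM s : s \isn't a GRing.unit -> near s.
  move=> /xU[b [_ ->]]; elim/big_ind: _ => [|y z|i _].
  - exists 0, 0; split=> [j|]; first by rewrite mxE idealr0.
    by rewrite !map_mx0 !mul0mx addr0; apply: drow0.
  - move=> [a1 [b1 [h1 e1]]] [a2 [b2 [h2 e2]]]; exists (a1 + a2), (b1 + b2); split=> [j|].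
      by rewrite mxE rpredD.
    rewrite /d drowD // -/d e1 e2 !map_mxD !mulmxDl -!addrA; congr (_ + _).
    by rewrite addrCA.
  - have [a1 e1] := spanX i; have [b1 e2] := spanS (b i).
    exists (b i *: a1), (x i *: b1); split=> [j|].
      rewrite mxE mulrC; apply: idealMr; apply/hN/xU.
      by have := mpow_gen (x := x) (k := 0) (a := 1) i I; rewrite mulr1.
    by rewrite /d drowM // -/d e1 e2 !map_mxZ -!scalemxAl addrC.
(* [galg] provides p over K[ys] with p(g_k) in P and p'(g_k) outside P. As p(g_k) is a nonunit,
   [near] applies to it, and the chain rule is solved for d(g_k) by dividing by the unit p'(g_k). *)
have /choice[AB hAB] k : exists ab : 'rV[S]_(c + e) * 'rV[S]_n,
    (forall j, ab.2 0 j \in N) /\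
    d (iota (g k)) = map_mx psi ab.1 *m DU + map_mx psi ab.2 *m DG.
  have [|p [hp Pp Pp']] := galg (g k); first exact: codom_f.
  have [|a [b [hb e1]]] := nearM (iota p.[g k]).
    by apply/loc_nonunitP/loc_nonunit_inj.
  have [i|v [a' hv]] :=
      inspan_horner (psi := psi) (T := DU) (p := map_poly iota p) derDelta (iota (g k)).
    by rewrite coef_map; apply: spanA (hp i).
  rewrite deriv_map !horner_map -/d e1 hv /= => e2.
  have Uu : iota p^`().[g k] \is a GRing.unit by apply: loc_at_unit; apply/negP.
  have pu : psi (iota p^`().[g k]) != 0 by rewrite -unitfE rmorph_unit.
  exists ((iota p^`().[g k])^-1 *: (a - a'), (iota p^`().[g k])^-1 *: b); split=> [j|] /=.
    by rewrite mxE idealMr.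
  apply: (scalerI pu); rewrite !map_mxZ -!scalemxAl scalerDr !scalerA rmorphV //.
  rewrite divff // !scale1r map_mxB mulmxBl addrAC e2.
  by rewrite addrAC subrr add0r.
pose A := \matrix_(k < n) (AB k).1; pose B := \matrix_(k < n) (AB k).2.
have eDG : DG = map_mx psi A *m DU + map_mx psi B *m DG.
  apply/row_matrixP => k; rewrite linearD /= !row_mul -!map_row !rowK.
  by have [_] := hAB k.
have {}eDG := nakayama_rows hN _ eDG.
have spanU s : inspan psi DU (d s).
  apply: inspan_trans (spanS s) => k.
  rewrite eDG; first by rewrite row_mul -map_row; exists (row k (invmx (1%:M - B) *m A)).
  by move=> i j; rewrite mxE; have [] := hAB i.
have /choice[E hE] (i : 'I_(c + e)) : exists a : 'rV[S]_(c + e),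
    d (iota (nth 0 ws i)) = map_mx psi a *m DU.
  exact: spanU.
pose E' := \matrix_i E i.
(* The rows d(ws_i) form the identity matrix because [Delta] is dual to [ws]. As [DU] is square,
   [E'] is then its two-sided inverse, with entries from [S]. *)
have E1 : map_mx psi E' *m DU = 1%:M.
  apply/row_matrixP => i; rewrite row_mul -map_row rowK -hE.
  apply/rowP => j; rewrite !mxE; have [_ _ h] := hDelta j; exact: h.
have E2 := mulmx1C E1.
(* Multiplying d s by the inverse of [DU] gives its coordinates in the rows of [DU]; [D i] reads off
   the one belonging to x_i. *)
pose D (i : 'I_c) z := \sum_j Delta j z * (map_mx psi E') j (lshift e i).
have DE i s : D i (psi s) = (d s *m map_mx psi E') 0 (lshift e i).
  by rewrite mxE; apply: eq_bigr => j _; rewrite !mxE.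
exists c, x, F, psi, D; split=> //; split=> //; split; [|split; [|split; [|split]]].
- by move=> a /psi0; apply: prime_loc_unit.
- move=> i; split=> a b; rewrite /D.
    by rewrite -big_split /=; apply: eq_bigr => j _; rewrite (derD (derDelta j)) mulrDl.
  rewrite mulr_suml mulr_sumr -big_split /=; apply: eq_bigr => j _.
  by rewrite (derM (derDelta j)); ring.
- by move=> i k; rewrite /D big1 // => j _; rewrite DeltaK mul0r.
- move=> i s; have [a ea] := spanU s; exists (a 0 (lshift e i)).
  by rewrite DE ea -mulmxA E2 mulmx1 mxE.
- move=> i j; rewrite DE.
  have -> : d (x j) = row (lshift e j) DU by rewrite rowKu rowK.
  by rewrite -row_mul E2 !mxE (inj_eq (@lshift_inj _ _)) eq_sym.
Qed.

End LocalStructure.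

(** * Euler's formula and powers of the maximal ideal *)

Section Euler.
Variables (S : comUnitRingType) (c : nat) (x : 'I_c -> S).
Variables (F : fieldType) (psi : {rmorphism S -> F}) (D : 'I_c -> F -> F).
Hypotheses (natU : forall n, n.+1%:R \is a @GRing.unit S)
  (derD : forall i, derivation (D i))
  (Dpsi : forall i s, exists s', psi s' = D i (psi s))
  (Dx : forall i j, D i (psi (x j)) = (i == j)%:R).

(* Euler's formula for homogeneous forms: the field sum_i x_i D_i acts on
   M^k / M^(k+1) as multiplication by k. *)
Lemma euler k s : mpow x k s -> exists s' : 'I_c -> S,
  [/\ forall i, mpow x k.-1 (s' i), forall i, psi (s' i) = D i (psi s) &
      mpow x k.+1 (\sum_i x i * s' i - k%:R * s)].
Proof.
elim: k s => [|k IH] s.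
  move=> _; have /choice[s' hs'] i : exists s', psi s' = D i (psi s) by exact: Dpsi.
  by exists s'; split=> //; rewrite mul0r subr0; exists s'.
move=> [b [hb ->]]; have /choice[t ht] l := IH _ (hb l).
exists (fun i => b i + \sum_l x l * t l i); split=> [i|i|].
- rewrite /=; apply: (idealD (mpow_ideal x k) (hb i)).
  apply: (@ideal_sum _ (mpow x k)) => [|l _]; first exact: mpow_ideal.
  case: k {IH hb} ht => // k ht.
  by apply: mpow_gen; have [h _ _] := ht l; apply: h.
- rewrite rmorphD !rmorph_sum (der_sum (derD i)) /=.
  rewrite [RHS](eq_bigr (fun l => (i == l)%:R * psi (b l) + psi (x l) * D i (psi (b l)))).
    have eb : \sum_l (i == l)%:R * psi (b l) = psi (b i).
      rewrite (bigD1 i) //= eqxx mul1r big1 ?addr0 // => l.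
      by rewrite eq_sym => /negbTE ->; rewrite mul0r.
    rewrite big_split /= eb; congr (_ + _); apply: eq_bigr => l _.
    by rewrite rmorphM; have [_ -> _] := ht l.
  by move=> l _; rewrite rmorphM (derM (derD i)) Dx.
- exists (fun l => \sum_i x i * t l i - k%:R * b l); split=> [l|].
    by have [_ _] := ht l.
  under eq_bigr do rewrite mulrDr mulr_sumr.
  rewrite big_split /= exchange_big /=.
  have cancel (A B : S) : A + B - k.+1%:R * A = B - k%:R * A by rewrite -natr1; ring.
  rewrite cancel mulr_sumr -sumrB; apply: eq_bigr => l _.
  rewrite mulrBr mulr_sumr mulrCA; congr (_ - _); apply: eq_bigr => i _.
  by rewrite mulrCA.
Qed.

(** Euler's formula puts (k+1) s into M^(k+2) once the derivatives of s lie in M^(k+1), and k+1 is a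
    unit. The hypothesis ranges over all lifts of the derivatives, as [psi] is not known to be
    injective here. *)
Lemma euler_step k s : mpow x k.+1 s ->
    (forall s' : 'I_c -> S, (forall i, psi (s' i) = D i (psi s)) ->
       forall i, mpow x k.+1 (s' i)) ->
  mpow x k.+2 s.
Proof.
move=> /euler[s' [_ h1 h2]] /(_ s' h1) h3.
rewrite -[s](mulKr (natU k)); apply: idealMl; first exact: mpow_ideal.
have -> : k.+1%:R * s = \sum_i x i * s' i - (\sum_i x i * s' i - k.+1%:R * s) by ring.
apply: (idealB (mpow_ideal x _)) => //.
by apply: (@ideal_sum _ (mpow x k.+2)) => [|i _]; [exact: mpow_ideal|exact: mpow_gen].
Qed.

(* With Krull's intersection theorem this makes psi injective, and so shows that
   a regular local ring is a domain. *)
Lemma ker_sub_mpow : (forall a, psi a = 0 -> mpow x 1 a) ->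
  forall k a, psi a = 0 -> mpow x k a.
Proof.
move=> h1; elim=> // -[|k] IH a a0; first exact: h1.
apply: euler_step; first exact: IH.
by move=> s' hs' i; apply: IH; rewrite hs' a0 der0.
Qed.

End Euler.

Lemma common_denominator (R : comNzRingType) (F : fieldType)
    (phi : {rmorphism R -> F}) (P : prime_idealr R) n (z : 'I_n -> F) :
    (forall b, b \notin P -> phi b != 0) ->
    (forall k, exists a b, b \notin P /\ z k = phi a / phi b) ->
  exists2 s, s \notin P & forall k, exists r, phi r = phi s * z k.
Proof.
move=> hP hz; have /choice[ab hab] k : exists ab, ab.2 \notin P /\ z k = phi ab.1 / phi ab.2.
  by have [a [b h]] := hz k; exists (a, b).
exists (\prod_k (ab k).2).
  elim/big_ind: _ => [|a b Pa Pb|k _]; [by rewrite idealr1| |by have [] := hab k].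
  by rewrite prime_idealrM negb_or Pa.
move=> k; have [Pb ->] := hab k.
exists ((ab k).1 * \prod_(j | j != k) (ab j).2).
rewrite [in RHS](bigD1 k) //= !rmorphM /=; field.
exact: hP.
Qed.

(** * Derivations of R and the ideals stable under them *)

Section AlgebraDerivations.
Variables (K : fieldType) (R : comAlgType K).

Definition alg_derivation (E : R -> R) : Prop :=
  derivation E /\ forall c : K, E c%:A = 0.

Variables (n : nat) (g : 'I_n -> R).
Hypothesis gen : forall A : subalgClosed R, (forall i, g i \in A) -> forall r, r \in A.

(** A common denominator s of the images of the finitely many generators makes sD map phi(R) into
    itself. *)
Lemma derivation_descends (F : fieldType) (phi : {rmorphism R -> F}) (D : F -> F)
    (P : prime_idealr R) : injective phi -> derivation D ->
    (forall c : K, D (phi c%:A) = 0) ->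
    (forall b, b \notin P -> phi b != 0) ->
    (forall k, exists a b, b \notin P /\ D (phi (g k)) = phi a / phi b) ->
  exists E s, [/\ alg_derivation E, s \notin P & forall r, phi (E r) = phi s * D (phi r)].
Proof.
move=> phi_inj hD DK hP /(common_denominator hP)[s Ps hs].
have /choice[E hE] : forall r, exists r', phi r' = phi s * D (phi r).
  apply: (fin_gen_ind gen) => [c|a b [a' ha] [b' hb]|a b [a' ha] [b' hb]|//].
  - by exists 0; rewrite DK rmorph0 mulr0.
  - by exists (a' + b'); rewrite !rmorphD (derD hD) mulrDr ha hb.
  - by exists (a' * b + a * b'); rewrite !(rmorphD, rmorphM) (derM hD) ha hb /=; ring.
exists E, s; split=> //; split; first split.
- by move=> a b; apply: phi_inj; rewrite hE !rmorphD (derD hD) mulrDr !hE.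
- by move=> a b; apply: phi_inj; rewrite hE !(rmorphD, rmorphM) (derM hD) !hE /=; ring.
- by move=> c; apply: phi_inj; rewrite hE DK mulr0 rmorph0.
Qed.

Hypothesis charK : [pchar K] =i pred0.

Variable P : prime_idealr R.
Local Notation S := (loc_at P).
Local Notation iota := (loc_inj (compl_prime P) : R -> S).
Hypothesis regS : regular_local_ring S.

Lemma loc_nat_unit k : k.+1%:R \is a @GRing.unit S.
Proof.
rewrite -(rmorph_nat iota); apply: loc_at_unit.
have /pcharf0P ch := charK.
have e1 : 1 = ((k.+1%:R : K)^-1)%:A * k.+1%:R :> R.
  by rewrite mulr_natr -scaler_nat scalerA mulfV ?scale1r // ch.
by apply/negP => h; have := idealr1 P; rewrite e1 idealMr.
Qed.

(** The map [psi] to a field is injective: its kernel lies in every power of the maximal ideal, and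
    these intersect in zero. *)
Lemma regular_loc_domain (a b : S) : a * b = 0 -> a = 0 \/ b = 0.
Proof.
have [c [x [F [psi [D [xU [krull [psi0 [hD [DK [Dpsi Dx]]]]]]]]]]] :=
  local_structure charK gen regS.
have psi_inj r : psi r = 0 -> r = 0.
  move=> r0; apply: krull => k; apply: (ker_sub_mpow loc_nat_unit hD Dpsi Dx) => //.
  by move=> s /psi0 /xU.
move=> ab0; have /eqP := congr1 psi ab0.
by rewrite rmorphM rmorph0 mulf_eq0 => /orP[] /eqP/psi_inj; [left|right].
Qed.

(** By induction J lies in every M^k: up to a unit, each D_i is induced by a derivation of R, under
    which J is stable, so [euler_step] raises the exponent. Krull's theorem then gives zero. *)
Lemma stable_ideal_eq0 (J : R -> Prop) : injective iota -> is_ideal J ->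
    (forall E r, alg_derivation E -> J r -> J (E r)) ->
    (forall r, J r -> r \in P) ->
  forall r, J r -> r = 0.
Proof.
move=> iota_inj hJ Jder JP.
have [c [x [F [psi [D [xU [krull [psi0 [hD [DK [Dpsi Dx]]]]]]]]]]] :=
  local_structure charK gen regS.
have psi_inj r : psi r = 0 -> r = 0.
  move=> r0; apply: krull => k; apply: (ker_sub_mpow loc_nat_unit hD Dpsi Dx) => //.
  by move=> s /psi0 /xU.
have psiI : injective psi.
  by move=> a b e; apply/eqP; rewrite -subr_eq0; apply/eqP/psi_inj; rewrite rmorphB e subrr.
pose phi : {rmorphism R -> F} := psi \o iota.
have phiI : injective phi by apply: inj_comp.
have hP b : b \notin P -> phi b != 0.
  by move=> /(loc_at_unit (P := P)) Ub; rewrite -unitfE rmorph_unit.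
have hE i : exists E s, [/\ alg_derivation E, s \notin P &
    forall r, phi (E r) = phi s * D i (phi r)].
  apply: (derivation_descends phiI (hD i) (DK i) hP) => k; have [s' hs'] := Dpsi i (iota (g k)).
  have [a [b [Pb e]]] := loc_at_frac s'; exists a, b; split=> //.
  by rewrite /phi /= -hs' e rmorphM rmorphV ?loc_at_unit.
suff H k r : J r -> mpow x k (iota r).
  move=> r Jr; apply: iota_inj; rewrite rmorph0; apply: krull => k; exact: H.
elim: k r => [//|[|k] IH] r Jr.
  by apply/xU/loc_nonunitP/loc_nonunit_inj/JP.
apply: (euler_step loc_nat_unit hD Dpsi Dx); first exact: IH.
move=> s' hs' i; have [E [s [dE Ps e]]] := hE i.
have Us := loc_at_unit Ps.
have -> : s' i = (iota s)^-1 * iota (E r).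
  apply: (mulrI Us); rewrite mulVKr //; apply: psiI.
  by rewrite rmorphM hs' -[RHS]/(phi (E r)) e.
by apply: idealMl; [exact: mpow_ideal|apply/IH/Jder].
Qed.

End AlgebraDerivations.

(** * Differential operators *)

Section DiffOps.
Variables (K : fieldType) (A : comAlgType K).
Implicit Types (delta eps : A -> A) (a b r u : A).
Local Notation dle := (@diffop_le K A).

Lemma diffop_linear n delta : dle n delta -> linear delta.
Proof.
case: n => [[r ->] c a b|n []//]; by rewrite mulrDr scalerAr.
Qed.

Lemma diffop0 n : dle n (fun=> 0).
Proof.
elim: n => [|n IH]; first by exists 0; apply/funext => x; rewrite mul0r.
split=> [c a b|r]; first by rewrite scaler0 addr0.
by have -> : (fun=> 0 - r * 0) = (fun=> 0) :> (A -> A) by apply/funext => x; rewrite mulr0 subr0.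
Qed.

Lemma diffopD n delta eps : dle n delta -> dle n eps ->
  dle n (fun x => delta x + eps x).
Proof.
elim: n delta eps => [_ _ [r ->] [s ->]|n IH delta eps [ld hd] [le he]].
  by exists (r + s); apply/funext => x; rewrite mulrDl.
split=> [c a b|r]; first by rewrite ld le scalerDr addrACA.
rewrite [X in dle _ X](_ : _ = fun x => (delta (r * x) - r * delta x) + (eps (r * x) - r * eps x)).
  exact: (IH _ _ (hd r) (he r)).
by apply/funext => x; ring.
Qed.

Lemma diffopMl n a delta : dle n delta -> dle n (fun x => a * delta x).
Proof.
elim: n delta => [_ [r ->]|n IH delta [ld hd]].
  by exists (a * r); apply/funext => x; rewrite mulrA.
split=> [c b b'|r]; first by rewrite ld mulrDr scalerAr.
rewrite [X in dle _ X](_ : _ = fun x => a * (delta (r * x) - r * delta x)).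
  exact: (IH _ (hd r)).
by apply/funext => x; ring.
Qed.

Lemma diffopMr n a delta : dle n delta -> dle n (fun x => delta (a * x)).
Proof.
elim: n delta => [_ [r ->]|n IH delta [ld hd]].
  by exists (r * a); apply/funext => x; rewrite mulrA.
split=> [c b b'|r]; first by rewrite mulrDr -scalerAr ld.
rewrite [X in dle _ X](_ : _ = fun x => delta (r * (a * x)) - r * delta (a * x)).
  exact: (IH _ (hd r)).
by apply/funext => x; rewrite mulrCA.
Qed.

Lemma diffopS n delta : dle n delta -> dle n.+1 delta.
Proof.
elim: n delta => [|n IH] delta h; split; try exact: diffop_linear h.
  move=> r; have [s ->] := h.
  by exists 0; apply/funext => x; ring.
by move=> r; have [_ hd] := h; apply: (IH _ (hd r)).
Qed.

Lemma diffopW m n delta : (m <= n)%N -> dle m delta -> dle n delta.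
Proof. by move=> /subnK <-; elim: (n - m)%N => // k IH /IH; apply: diffopS. Qed.

(** Double induction on the orders through [delta eps, r] = delta [eps, r] + [delta, r] eps. *)
Lemma diffop_comp m n delta eps : dle m delta -> dle n eps ->
  dle (m + n) (fun x => delta (eps x)).
Proof.
elim: m n delta eps => [n _ eps [r ->] h|m IHm n]; first exact: diffopMl.
elim: n => [|n IHn] delta eps hd he.
  by have [r ->] := he; rewrite addn0; apply: diffopMr.
have ld := diffop_linear hd; have le := diffop_linear he.
have lB x y : delta (x - y) = delta x - delta y.
  by rewrite addrC -scaleN1r ld scaleN1r addrC.
rewrite addnS; split=> [c a b|r]; first by rewrite le ld.
rewrite [X in dle _ X](_ : _ = fun x => delta (eps (r * x) - r * eps x) +
  (delta (r * eps x) - r * delta (eps x))); last by apply/funext => x; rewrite lB; ring.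
apply: diffopD; first by have [_ he'] := he; apply: (IHn _ _ hd (he' r)).
have [_ hd'] := hd.
by rewrite addSnnS; apply: (IHm n.+1 (fun x => delta (r * x) - r * delta x)) (hd' r) he.
Qed.

Lemma alg_derivation_linear (E : A -> A) : alg_derivation E -> linear E.
Proof.
move=> [hE EK] c a b; rewrite (derD hE) -{1}[a]mul1r scalerAl.
by rewrite (derM hE) EK mul0r add0r -scalerAl mul1r.
Qed.

Lemma alg_derivation_diffop (E : A -> A) : alg_derivation E -> dle 1 E.
Proof.
move=> hE; split=> [|r]; first exact: alg_derivation_linear.
by exists (E r); apply/funext => x; rewrite (derM hE.1) addrK.
Qed.

(** Since delta(a u) = 0, the commutator [delta, a] takes the value - a delta(u) at u, and it has
    smaller order. *)
Lemma ann_diffop k delta u a : dle k delta -> u * a = 0 -> a ^+ k.+1 * delta u = 0.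
Proof.
move=> + ua; elim: k delta => [_ [r ->]|k IH delta [ld hd]].
  by rewrite expr1 mulrCA [a * u]mulrC ua mulr0.
have d0 : delta 0 = 0 by have := ld (-1) 0 0; rewrite scaler0 addr0 scaleN1r addNr.
have := IH _ (hd a); rewrite [a * u]mulrC ua d0 sub0r mulrN => /eqP.
by rewrite oppr_eq0 mulrA -exprSr => /eqP.
Qed.

(** For fixed [k] and [a] the possible [b] form an ideal; working in it avoids writing operators
    down. *)
Definition reach k a b := exists2 delta, dle k delta & delta a = b.

Lemma reach_ideal k a : is_ideal (reach k a).
Proof.
split=> [|_ _ [d hd <-] [e he <-]|r _ [d hd <-]].
- by exists (fun=> 0) => //; apply: diffop0.
- by exists (fun x => d x + e x) => //; apply: diffopD.
- by exists (fun x => r * d x) => //; apply: diffopMl.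
Qed.

Lemma reach_trans k l a b u : reach k a b -> reach l b u -> reach (k + l) a u.
Proof.
move=> [d hd <-] [e he <-]; exists (fun x => e (d x)) => //.
by rewrite addnC; apply: diffop_comp.
Qed.

Lemma reachW k l a b : (k <= l)%N -> reach k a b -> reach l a b.
Proof. by move=> le_kl [d hd <-]; exists d => //; apply: diffopW hd. Qed.

Lemma reach_refl k a : reach k a a.
Proof.
apply: (@reachW 0) => //; exists (fun x => 1 * x); last by rewrite mul1r.
by exists 1.
Qed.

Lemma reach_der k a b (E : A -> A) : alg_derivation E -> reach k a b ->
  reach k.+1 a (E b).
Proof.
move=> hE h; rewrite -addn1; apply: reach_trans h _; exists E => //.
exact: alg_derivation_diffop.
Qed.

Hypothesis charK : [pchar K] =i pred0.

Lemma ideal_natr (I : A -> Prop) n a : is_ideal I -> I (n.+1%:R * a) -> I a.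
Proof.
move=> hI h; have /pcharf0P ch := charK.
have -> : a = ((n.+1%:R : K)^-1)%:A * (n.+1%:R * a).
  by rewrite mulrA mulr_natr -scaler_nat scalerA mulfV ?scale1r ?mul1r // ch.
exact: idealMl.
Qed.

(* The argument showing that the radical of a differential ideal is
   differential in characteristic zero, with the order of operators recorded. *)
Lemma reach_radical_der k a b N (E : A -> A) : alg_derivation E ->
  reach k a (b ^+ N) -> reach (k + N) a (E b ^+ (2 * N)).
Proof.
move=> hE h.
(* E is applied j times. In E b E(b^(M+1) (E b)^(2j)) the term that differentiates (E b)^(2j) is a
   multiple of the previous element, which leaves (M+1) b^M (E b)^(2j+2). *)
suff H j : (j <= N)%N -> reach (k + j) a (b ^+ (N - j) * E b ^+ (2 * j)).
  by have := H N (leqnn N); rewrite subnn expr0 mul1r.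
elim: j => [_|j IH lt_j]; first by rewrite addn0 subn0 muln0 expr0 mulr1.
have {}IH := IH (ltnW lt_j); have hI := reach_ideal (k + j.+1) a.
have IH' : reach (k + j.+1) a (b ^+ (N - j) * E b ^+ (2 * j)).
  by apply: reachW IH; rewrite addnS.
have := reach_der hE IH; rewrite -addnS (derM hE.1).
have -> : (N - j = (N - j.+1).+1)%N by rewrite subnSK.
set M := (N - j.+1)%N; rewrite (derXS hE.1) => h1.
apply: (ideal_natr (n := M) hI).
have e2 : E (E b ^+ (2 * j)) * E b = (2 * j)%:R * E (E b) * E b ^+ (2 * j).
  case: j {IH IH' lt_j h1 hI} @M => [|j] M; first by rewrite muln0 expr0 (der1 hE.1) !mul0r.
  by rewrite (_ : (2 * j.+1 = (2 * j).+1.+1)%N) ?mulnS // (derXS hE.1) !exprS; ring.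
have -> : M.+1%:R * (b ^+ M * E b ^+ (2 * j.+1)) =
    E b * (M.+1%:R * b ^+ M * E b * E b ^+ (2 * j) + b ^+ M.+1 * E (E b ^+ (2 * j)))
    - ((2 * j)%:R * E (E b)) * (b ^+ M.+1 * E b ^+ (2 * j)).
  rewrite (_ : (2 * j.+1 = (2 * j).+2)%N) ?mulnS // !exprS mulrDr.
  have -> : E b * (b * b ^+ M * E (E b ^+ (2 * j))) = b * b ^+ M * (E (E b ^+ (2 * j)) * E b).
    by ring.
  by rewrite e2; ring.
apply: (idealB hI); apply: idealMl => //.
by rewrite /M subnSK.
Qed.

End DiffOps.

(** * Operators obtained from the Bernstein-Sato equation *)

Section FunctionalEquation.
Variables (K : fieldType) (R : comAlgType K) (f : R) (hf : GRing.lreg f).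

Lemma loc_away_inj : injective (loc_inj (powers hf)).
Proof.
move=> x y /FracP[u /asboolP[k ->]]; rewrite !mulr1 => e.
by apply: (@lregX _ f k hf).
Qed.

Lemma loc_away_scale (c : K) (r : R) :
  c *: loc_inj (powers hf) r = loc_inj (powers hf) (c *: r).
Proof.
transitivity (loc_inj (powers hf) c%:A * loc_inj (powers hf) r); first by [].
by rewrite -rmorphM -scalerAl mul1r.
Qed.

(** At a natural number n the scalar b(n) is invertible, so the equation, which descends to R by
    injectivity of R -> R_f, sends f^(n+1) to f^n. The order is at most the maximum [c] of the
    orders of the coefficients, whatever n is; n such steps are composed. *)
Lemma bs_reach (b : {poly K}) : bs_occurs hf b -> (forall n : nat, ~~ root b n%:R) ->
  exists c, forall n, reach (c * n) (f ^+ n) 1.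
Proof.
move=> [m [delta [/choice[N hN] [ext [hext heq]]]]] nroot.
pose c := \max_i N i.
have step n : reach c (f ^+ n.+1) (f ^+ n).
  have bn : b.[n%:R] != 0 by rewrite -rootE.
  have := heq n; rewrite (_ : n%:Z + 1 = n.+1%:Z); last by rewrite -addn1.
  rewrite -!exprnP -!rmorphXn /=.
  under eq_bigr do rewrite (hext _).2 loc_away_scale.
  rewrite loc_away_scale -rmorph_sum => /loc_away_inj.
  rewrite -pmulrn => e.
  have -> : f ^+ n =
      (b.[n%:R]^-1)%:A * \sum_(i < m) (n%:R : K) ^+ i *: delta i (f ^+ n.+1).
    by rewrite e -scalerAl mul1r scalerA mulVf ?scale1r.
  apply: idealMl; first exact: reach_ideal.
  apply: (@ideal_sum _ (reach c _)) => [|i _]; first exact: reach_ideal.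
  rewrite -[delta i _]mul1r scalerAl; apply: idealMl; first exact: reach_ideal.
  apply: reachW (_ : (N i <= c)%N) _; first exact: leq_bigmax.
  by exists (delta i).
exists c; elim=> [|n IH]; first by rewrite expr0; apply: reach_refl.
by rewrite mulnS; apply: reach_trans (step n) IH.
Qed.

End FunctionalEquation.

(** * Graded rings *)

Section GradedDomain.
Variables (K : fieldType) (R : comAlgType K) (G : nat -> submodClosed R).
Hypotheses (gradedR : grading G) (connectedR : grading_connected G).

(** A multiplicative separated filtration, whose member for k = 1 is [irrelevant_ideal]. *)
Definition deg_ge (k : nat) (r : R) : Prop :=
  exists n (u : nat -> R), (forall i, u i \in G i) /\ r = \sum_(k <= i < n) u i.

Lemma deg_ge_hom k j x : (k <= j)%N -> x \in G j -> deg_ge k x.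
Proof.
move=> le_kj Gx; exists j.+1, (fun i => if i == j then x else 0); split=> [i|].
  by case: eqP => [->|_] //; apply: rpred0.
rewrite big_nat_recr //= eqxx big_nat big1 ?add0r // => i /andP[_ lt_ij].
by rewrite ltn_eqF.
Qed.

Lemma deg_ge0 k : deg_ge k 0.
Proof. by apply: (@deg_ge_hom k k) => //; apply: rpred0. Qed.

Lemma deg_ge_pad k n N (u : nat -> R) : (n <= N)%N -> \sum_(k <= i < n) u i =
  \sum_(k <= i < N) (if (i < n)%N then u i else 0).
Proof.
move=> le_nN; have [le_kn|lt_nk] := leqP k n.
  rewrite (big_cat_nat le_kn le_nN) /= [X in _ + X]big_nat [X in _ + X]big1 ?addr0.
    by apply: eq_big_nat => i /andP[_ ->].
  by move=> i /andP[le_ni _]; rewrite ltnNge le_ni.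
rewrite big_geq ?(ltnW lt_nk) // big_nat big1 // => i /andP[le_ki _].
by rewrite ltnNge ltnW // (leq_trans lt_nk).
Qed.

Lemma deg_geD k a b : deg_ge k a -> deg_ge k b -> deg_ge k (a + b).
Proof.
move=> [n [u [hu ->]]] [m [v [hv ->]]].
rewrite (@deg_ge_pad k n (maxn n m)) ?leq_maxl // (@deg_ge_pad k m (maxn n m)) ?leq_maxr //.
rewrite -big_split /=; exists (maxn n m).
exists (fun i => (if (i < n)%N then u i else 0) + (if (i < m)%N then v i else 0)); split=> // i.
by apply: rpredD; case: ifP => // _; apply: rpred0.
Qed.

Lemma deg_ge_sum k n m (u : nat -> R) : (forall i, (m <= i)%N -> deg_ge k (u i)) ->
  deg_ge k (\sum_(m <= i < n) u i).
Proof.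
move=> hu; rewrite big_nat; elim/big_ind: _ => [|a b|i /andP[le_mi _]].
- exact: deg_ge0.
- exact: deg_geD.
- exact: hu.
Qed.

Lemma deg_geM k l a b : deg_ge k a -> deg_ge l b -> deg_ge (k + l) (a * b).
Proof.
move=> [n [u [hu ->]]] [m [v [hv ->]]]; rewrite mulr_suml.
apply: deg_ge_sum => i le_ki; rewrite mulr_sumr; apply: deg_ge_sum => j le_lj.
by apply: (@deg_ge_hom _ (i + j)); [apply: leq_add|apply: (grading_mul gradedR)].
Qed.

Lemma deg_ge_all r : deg_ge 0 r.
Proof.
have [n [u [hu ->]]] := grading_span gradedR r.
by exists n, u; rewrite big_mkord.
Qed.

Lemma deg_ge_separated a : (forall k, deg_ge k a) -> a = 0.
Proof.
move=> ha; have [n [u [hu e]]] := grading_span gradedR a.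
have [m [v [hv e']]] := ha n.
(* A sum of components below n minus a sum of components from n on is zero, so directness kills
   every component. *)
pose w i := if (i < n)%N then u i else -1 *: v i.
have hw i : w i \in G i by rewrite /w; case: ifP => // _; apply: rpredZ.
have [le_mn|lt_nm] := leqP m n; first by rewrite e' big_geq.
have w0 : \sum_(i < m) w i = 0.
  rewrite -(big_mkord xpredT w) (big_cat_nat (leq0n n) (ltnW lt_nm)) /=.
  have -> : \sum_(0 <= i < n) w i = \sum_(0 <= i < n) u i.
    by apply: eq_big_nat => i /andP[_ lt_in]; rewrite /w lt_in.
  have -> : \sum_(n <= i < m) w i = \sum_(n <= i < m) -1 *: v i.
    by apply: eq_big_nat => i /andP[le_ni _]; rewrite /w ltnNge le_ni.
  by rewrite -scaler_sumr -e' big_mkord -e scaleN1r subrr.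
rewrite e big1 // => i _.
have := grading_direct gradedR hw w0 (ltn_trans (ltn_ord i) lt_nm).
by rewrite /w ltn_ord.
Qed.

Lemma irrelevantZ (c : K) r : irrelevant_ideal G r -> irrelevant_ideal G (c *: r).
Proof.
move=> [n [u [hu ->]]]; exists n, (fun i => c *: u i); rewrite scaler_sumr.
by split=> // i; apply: rpredZ.
Qed.

Lemma irrelevantD a b : irrelevant_ideal G a -> irrelevant_ideal G b ->
  irrelevant_ideal G (a + b).
Proof. exact: deg_geD. Qed.

(** Otherwise 1, being equal to all its powers, would lie in every step of the filtration. *)
Lemma irrelevant1 : ~ irrelevant_ideal G 1.
Proof.
move=> h1; have /eqP[] := oner_neq0 R; apply: deg_ge_separated.
elim=> [|k IH]; first exact: deg_ge_all.
by rewrite -[1]mulr1; apply: (deg_geM (k := 1)).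
Qed.

(* An element with nonzero constant term is a unit in the completion, hence a
   nonzerodivisor. *)
Lemma irrelevant_zerodiv w a : w * a = 0 -> a <> 0 -> irrelevant_ideal G w.
Proof.
move=> wa0 a0; apply: contrapT => wN; apply: a0.
have [c [v [c0 hv e]]] : exists (c : K) (v : R), [/\ c != 0, deg_ge 1 v & w = c%:A + v].
  have [n [u [hu ew]]] := grading_span gradedR w.
  have /connectedR[c ec] := hu 0%N.
  case: n ew => [|n] ew.
    by case: wN; rewrite ew big_ord0; apply: deg_ge0.
  exists c, (\sum_(1 <= i < n.+1) u i).
  move: ew; rewrite -(big_mkord xpredT u) big_ltn // ec => ew; split=> //.
    apply/eqP => c0; apply: wN; exists n.+1, u; split=> //.
    by rewrite ew c0 scale0r add0r.
  by exists n.+1, u.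
have ea : a = (- c^-1 *: v) * a.
  have -> : v = w - c%:A by rewrite e addrC addKr.
  rewrite -scalerAl mulrBl wa0 sub0r -scalerAl mul1r scaleNr scalerN opprK scalerA.
  by rewrite mulVf ?scale1r.
apply: deg_ge_separated; elim=> [|k IH]; first exact: deg_ge_all.
by rewrite ea; apply: (deg_geM (k := 1)) => //; apply: irrelevantZ.
Qed.

Variables (f : R) (hf : GRing.lreg f).
Hypothesis loc_domain : forall (P : prime_idealr R), f \notin P ->
  forall a b : loc_at P, a * b = 0 -> a = 0 \/ b = 0.

(** As [f] is a nonzerodivisor, the annihilator of a nonzero a contains no power of [f], so it lies
    in a prime P not containing [f]. But a nilpotent a vanishes in the domain R_P and is killed by
    an element outside P. *)
Lemma loc_reduced (a : R) k : a ^+ k = 0 -> a = 0.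
Proof.
move=> ak0; apply: contrapT => a0.
have [||P [hP Pf]] := @prime_avoiding_powers R (fun u => u * a = 0) f.
- split=> [|u v hu hv|u v hv]; first by rewrite mul0r.
    by rewrite mulrDl hu hv addr0.
  by rewrite -mulrA hv mulr0.
- move=> n fa0; apply: a0; apply: (@lregX _ f n hf).
  by rewrite mulr0.
have /loc_inj_eq0[u Pu ua0] : loc_inj (compl_prime P) a = 0.
  have : loc_inj (compl_prime P) a ^+ k = 0 by rewrite -rmorphXn ak0 rmorph0.
  elim: k {ak0} => [/eqP|k IH]; first by rewrite expr0 oner_eq0.
  by rewrite exprS => /(loc_domain Pf)[].
by have := hP _ ua0; rewrite (negbTE Pu).
Qed.

Lemma graded_domain : (forall n, exists k, reach k (f ^+ n) 1) ->
  forall a b : R, a * b = 0 -> a = 0 \/ b = 0.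
Proof.
move=> hreach a b ab0; apply: contrapT => /not_orP[a0 b0].
(* Otherwise ann(a) + ann(b) lies in a prime P not containing [f], so neither a nor b vanishes in
   R_P, although their product does. *)
have [n [u [v [ua vb e]]]] : exists n u v, [/\ u * a = 0, v * b = 0 & f ^+ n = u + v].
  apply: contrapT => hn.
  have [||P [hP Pf]] := @prime_avoiding_powers R
      (fun w => exists u v, [/\ u * a = 0, v * b = 0 & w = u + v]) f.
  - split=> [|_ _ [u [v [ua vb ->]]] [u' [v' [ua' vb' ->]]]|w _ [u [v [ua vb ->]]]].
    + by exists 0, 0; rewrite !mul0r addr0.
    + by exists (u + u'), (v + v'); rewrite !mulrDl ua ua' vb vb' !addr0 addrACA.
    + by exists (w * u), (w * v); rewrite -!mulrA ua vb !mulr0 mulrDr.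
  - by move=> n [u [v h]]; apply: hn; exists n, u, v.
  have : loc_inj (compl_prime P) a * loc_inj (compl_prime P) b = 0.
    by rewrite -rmorphM ab0 rmorph0.
  case/(loc_domain Pf) => /loc_inj_eq0[u Pu hu].
    by move/negP: Pu; apply; apply: hP; exists u, 0; rewrite mul0r addr0.
  by move/negP: Pu; apply; apply: hP; exists 0, u; rewrite mul0r add0r.
have [k [delta hd d1]] := hreach n.
(* [delta w] is annihilated by [c ^+ k.+1], which is nonzero because R is reduced. *)
have zd w c : w * c = 0 -> c <> 0 -> irrelevant_ideal G (delta w).
  move=> wc c0; apply: (@irrelevant_zerodiv _ (c ^+ k.+1)).
    by rewrite mulrC; apply: ann_diffop hd wc.
  by move/loc_reduced.
apply: irrelevant1; rewrite -d1 e.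
have -> : delta (u + v) = delta u + delta v.
  by have := diffop_linear hd 1 u v; rewrite !scale1r.
by apply: irrelevantD; [apply: zd ua a0|apply: zd vb b0].
Qed.

End GradedDomain.

(** * Polynomials in algebraically independent elements *)

Section BoxPolynomials.
Variables (K : fieldType) (R : comAlgType K).
Hypothesis charK : [pchar K] =i pred0.
Implicit Types (ws : seq R) (p : {poly R}).

(* The values at ws of the polynomials of degree less than n in each variable. *)
Fixpoint box n ws (r : R) : Prop :=
  if ws is w :: ws' then
    exists p, [/\ (size p <= n)%N, forall i, box n ws' p`_i & r = p.[w]]
  else exists c : K, r = c%:A.

Lemma box_adj n ws r : box n ws r -> adj ws r.
Proof.
elim: ws r => [//|w ws IH] r [p [_ hp ->]]; exists p; split=> // i.
exact: IH (hp i).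
Qed.

Lemma boxZ n ws (c : K) r : box n ws r -> box n ws (c *: r).
Proof.
elim: ws r => [|w ws IH] r.
  by move=> [d ->]; exists (c * d); rewrite scalerA.
move=> [p [sp hp ->]]; exists (c%:A *: p); split=> [|i|].
- exact: leq_trans (size_scale_leq _ _) sp.
- by rewrite coefZ -scalerAl mul1r; apply: IH (hp i).
- by rewrite hornerZ -scalerAl mul1r.
Qed.

Lemma alg_derivation_adj0 (E : R -> R) ws r : alg_derivation E ->
  (forall j, (j < size ws)%N -> E (nth 0 ws j) = 0) -> adj ws r -> E r = 0.
Proof.
move=> hE; elim: ws r => [|w ws IH] r Ews; first by move=> [c ->]; apply: hE.2.
move=> [p [hp ->]]; rewrite (der_horner hE.1) (Ews 0%N) // mulr0 addr0.
rewrite big1 // => i _; rewrite (IH _ _ (hp i)) ?mul0r // => j.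
exact: (Ews j.+1).
Qed.

Lemma alg_derivationZ (E : R -> R) a : alg_derivation E ->
  alg_derivation (fun r => a * E r).
Proof.
move=> [hE EK]; split; last by move=> c; rewrite EK mulr0.
by split=> b b'; rewrite ?(derD hE) ?(derM hE); ring.
Qed.

(** From E(G) = G' h one gets h E(h^a G) - a E(h) h^a G = h^(a+2) G'. *)
Lemma reach_deriv_step (E : R -> R) (h G G' : R) a : alg_derivation E ->
  E G = G' * h -> reach 1 (h ^+ a * G) (h ^+ (a + 2) * G').
Proof.
move=> hE EG; have hI := reach_ideal 1 (h ^+ a * G).
have e : E (h ^+ a) * h = a%:R * E h * h ^+ a.
  case: a {hI} => [|a]; first by rewrite expr0 (der1 hE.1) !mul0r.
  by rewrite (derXS hE.1) exprS; ring.
have -> : h ^+ (a + 2) * G' = h * E (h ^+ a * G) - (a%:R * E h) * (h ^+ a * G).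
  rewrite (derM hE.1) EG mulrDr.
  have -> : h * (E (h ^+ a) * G) = E (h ^+ a) * h * G by ring.
  by rewrite e exprD expr2; ring.
apply: (idealB hI); apply: idealMl => //; last exact: reach_refl.
by apply: reach_der => //; apply: reach_refl.
Qed.

(** F is differentiated with respect to one variable until it is constant in it, then with respect
    to the next. Each differentiation costs order 1 and a factor h^2, and n of them suffice for each
    variable. *)
Lemma box_reach n (h : R) ws :
    aind (fun r => r = 0) ws ->
    (forall i, (i < size ws)%N -> exists2 E, alg_derivation E &
      forall j, (j < size ws)%N -> E (nth 0 ws j) = (i == j)%:R * h) ->
  forall G, box n ws G -> G <> 0 -> forall a,
  reach (n * size ws) (h ^+ a * G) (h ^+ (a + 2 * (n * size ws))).
Proof.
elim: ws => [_ _ _ [c ->] c0 a|w ws IH [hws _] hE].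
  rewrite /= !muln0 addn0; have {}c0 : c != 0.
    by apply/eqP => e; apply: c0; rewrite e scale0r.
  have eh : h ^+ a = (c^-1)%:A * (h ^+ a * c%:A).
    by rewrite mulrCA -scalerAl mul1r scalerA mulVf ?scale1r ?mulr1.
  by rewrite [X in reach _ _ X]eh; apply: idealMl; [exact: reach_ideal|exact: reach_refl].
have {}IH : forall G, box n ws G -> G <> 0 -> forall a,
    reach (n * size ws) (h ^+ a * G) (h ^+ (a + 2 * (n * size ws))).
  apply: IH => // i lt_i; have [E dE EE] := hE i.+1 lt_i.
  by exists E => // j lt_j; apply: (EE j.+1).
have [E dE EE] := hE 0%N isT.
have E0 r : adj ws r -> E r = 0.
  apply: alg_derivation_adj0 => // j lt_j.
  by rewrite (EE j.+1 lt_j) mul0r.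
have Ew : E w = h by rewrite (EE 0%N) // mul1r.
set N := (n * size ws)%N.
suff H s p : (size p <= s.+1)%N -> (forall i, box n ws p`_i) -> p != 0 -> forall a,
    reach (s + N) (h ^+ a * p.[w]) (h ^+ (a + 2 * (s + N))).
  move=> _ [p [sp hp ->]] pw a; rewrite mulnS; apply: H => //.
    exact: leqW.
  by apply/eqP => p0; apply: pw; rewrite p0 horner0.
elim: s p => [|s IHs] p sp hp pn0 a.
  have ep := size1_polyC sp.
  rewrite ep hornerC add0n; apply: IH (hp 0%N) _ a.
  by move=> p00; move: pn0; rewrite ep p00 eqxx.
(* If the degree is already below the bound, no differentiation takes place, and multiplying by h^2
   keeps the exponent uniform. *)
have [le_p|lt_p] := leqP (size p) s.+1.
  have h1 := IHs p le_p hp pn0 a.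
  rewrite (_ : (a + 2 * (s.+1 + N) = 2 + (a + 2 * (s + N)))%N); last by lia.
  rewrite exprD; apply: idealMl; first exact: reach_ideal.
  by apply: reachW h1; rewrite leq_add2r.
have s' : size p^`() = (size p).-1.
  exact/size_deriv_torsion_free/(alg_torsion_free charK).
have p'n0 : p^`() != 0.
  by rewrite -size_poly_gt0 s'; case: (size p) lt_p => [|[|k]].
have sp' : (size p^`() <= s.+1)%N by rewrite s'; case: (size p) sp.
have hp' i : box n ws p^`()`_i.
  by rewrite coef_deriv -scaler_nat; apply: boxZ.
have EG : E p.[w] = p^`().[w] * h.
  rewrite (der_horner dE.1) Ew big1 ?add0r // => i _.
  by rewrite E0 ?mul0r //; apply: box_adj (hp i).
have h2 := IHs _ sp' hp' p'n0 (a + 2)%N.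
rewrite (_ : (a + 2 * (s.+1 + N) = a + 2 + 2 * (s + N))%N); last by lia.
exact: (reach_trans (reach_deriv_step a dE EG) h2).
Qed.

(** The family consists of the monomials in [ws] with all exponents below n. *)
Lemma box_family n ws : aind (fun r => r = 0) ws ->
  exists (T : finType) (v : T -> R), [/\ #|T| = (n ^ size ws)%N,
    forall c : T -> K, box n ws (\sum_t c t *: v t) &
    forall c : T -> K, \sum_t c t *: v t = 0 -> forall t, c t = 0].
Proof.
elim: ws => [h|w ws IH [hws hw]].
  exists unit, (fun=> 1); split=> [|c|c e t]; first by rewrite card_unit.
    by exists (c tt); rewrite (big_pred1 tt) // => -[].
  move: e; rewrite (big_pred1 t) ?(unitE t); last by case; case: t.
  exact: h.
have [T [v [cT bT fT]]] := IH hws.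
exists ('I_n * T)%type, (fun it : 'I_n * T => w ^+ it.1 * v it.2).
pose p (c : 'I_n * T -> K) : {poly R} := \poly_(i < n) if insub i is Some j then \sum_t c (j, t) *: v t else 0.
have pw c : \sum_(it : 'I_n * T) c it *: (w ^+ it.1 * v it.2) = (p c).[w].
  transitivity (\sum_(i < n) \sum_t c (i, t) *: (w ^+ i * v t)).
    by rewrite pair_bigA /=; apply: eq_bigr => -[].
  rewrite horner_poly.
  apply: eq_bigr => i _; rewrite valK mulr_suml; apply: eq_bigr => t _.
  by rewrite -scalerAl mulrC.
have pc c i : box n ws (p c)`_i.
  have b0 : box n ws 0.
    have -> : 0 = \sum_t (0 : K) *: v t; last exact: bT.
    by rewrite big1 // => t _; rewrite scale0r.
  by rewrite coef_poly; case: ifP => // _; case: insub.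
split=> [|c|c].
- by rewrite card_prod card_ord cT expnS.
- by rewrite pw; exists (p c); split=> //; apply: size_poly.
- rewrite pw => /hw p0 [i t].
  have {}p0 : p c = 0 by apply: p0 => j; apply: box_adj (pc c j).
  apply: (fT (fun t => c (i, t))).
  by have := congr1 (fun q : {poly R} => q`_i) p0; rewrite coef_poly ltn_ord valK coef0.
Qed.

End BoxPolynomials.

(** * Effective simplicity and counting *)

Lemma krull_dim_chain (A : comNzRingType) : krull_dim A = 0%N \/
  exists P : 'I_(krull_dim A).+1 -> prime_idealr A, prime_chain P.
Proof.
rewrite /krull_dim; case: (pselect (exists d, is_krull_dim A d)) => [h|h]; last first.
  by left; apply: xgetPN => d hd; apply: h; exists d.
by right; case: (xgetPex 0%N h).
Qed.

Section EffectiveSimplicity.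
Variables (K : fieldType) (R : comAlgType K) (charK : [pchar K] =i pred0).

(** A chain of primes of maximal length yields the elements by [aind_chain]. The value 0, which
    includes the default value of [krull_dim], is met by the empty sequence. *)
Lemma aind_krull_dim : exists ws : seq R,
  size ws = krull_dim R /\ aind (fun r => r = 0) ws.
Proof.
have [->|[P chP]] := krull_dim_chain R.
  by exists [::]; split=> //; apply: aind_nil; [exact: zero_is_ideal|exact/eqP/oner_neq0].
move: (krull_dim R) P chP => d P chP.
pose Q (i : nat) (r : R) : Prop := r \in P (inord i).
have idQ i : is_ideal (Q i) by exact: idealr_is_ideal.
have [i lt_id||ws [sz hws]] := @aind_chain K R d Q [::] _ (idQ d).
- have lt_i : ((inord i : 'I_d.+1) < (inord i.+1 : 'I_d.+1))%N.
    by rewrite !inordK // ltnS // ltnW.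
  have [PP [z z1 z0]] := chP _ _ lt_i; split; last by exists z => //; apply/negP.
    split=> // a b; rewrite /Q prime_idealrM.
    by case/orP; [left|right].
  by move=> r; apply: PP.
- by apply: aind_nil => //; rewrite /Q idealr1.
- exists ws; rewrite sz addn0; split=> //.
  by apply: aindS hws => _ ->; apply: ideal0 (idQ _).
Qed.

Variables (n : nat) (g : 'I_n -> R).
Hypothesis gen : forall A : subalgClosed R, (forall i, g i \in A) -> forall r, r \in A.
Hypothesis domR : forall a b : R, a * b = 0 -> a = 0 \/ b = 0.

(** The partial derivatives on Frac(R) become derivations of R after multiplication by denominators.
    With [h] the product of these, each one is rescaled by the remaining factors. *)
Lemma dual_alg_derivations ws : aind (fun r : R => r = 0) ws ->
  exists2 h : R, h <> 0 & forall i, (i < size ws)%N ->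
    exists2 E : R -> R, alg_derivation E &
      forall j, (j < size ws)%N -> E (nth 0 ws j) = (i == j)%:R * h.
Proof.
move=> hws; have [||Z hZ] := @bundle_prime R (fun r => r = 0) _ _ domR.
- exact: zero_is_ideal.
- by move/eqP; rewrite oner_eq0.
have [F [phi [phi0 phiF]]] := exists_fraction_field Z.
have phi_inj : injective phi.
  move=> a b e; apply/eqP; rewrite -subr_eq0; apply/eqP/hZ/phi0.
  by rewrite rmorphB e subrr.
have nZ b : b \notin Z -> phi b != 0 by apply: contraNneq => /phi0.
have {}hws : aind (fun r => phi r = 0) ws by apply: aindS hws => r /phi0/hZ.
have charF : [pchar F] =i pred0 by apply: (char0_morph phi).
have /choice[Es hEs] (i : 'I_(size ws)) : exists Es : (R -> R) * R,
    [/\ alg_derivation Es.1, Es.2 \notin Z &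
    forall j, (j < size ws)%N -> Es.1 (nth 0 ws j) = (i == j :> nat)%:R * Es.2].
  have [D [hD DK Dw]] :=
    dual_derivation (mkseq (fun j => (i == j :> nat)%:R) (size ws)) charF hws.
  have [|E [s [dE Zs hE]]] := derivation_descends gen phi_inj hD DK nZ.
    by move=> k; apply: phiF.
  exists (E, s); split=> // j lt_j; apply: phi_inj.
  by rewrite hE Dw // nth_mkseq // mulrC rmorphM rmorph_nat.
exists (\prod_i (Es i).2).
  apply/hZ/negP; elim/big_ind: _ => [|a b Za Zb|i _]; [by rewrite idealr1| |by have [] := hEs i].
  by rewrite prime_idealrM negb_or Za.
move=> i lt_i; pose o := Ordinal lt_i; have [dE _ EE] := hEs o.
exists (fun r => (\prod_(j | j != o) (Es j).2) * (Es o).1 r).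
  exact: alg_derivationZ.
by move=> j lt_j; rewrite EE // [in RHS](bigD1 o) //=; ring.
Qed.

Variables (f : R) (c : nat).
Hypothesis regf : forall P : prime_idealr R, f \notin P -> regular_local_ring (loc_at P).
Hypothesis reachf : forall m, reach (c * m) (f ^+ m) 1.

Lemma effective_simplicity ws : aind (fun r : R => r = 0) ws ->
  exists C, forall m F, box m.+1 ws F -> F <> 0 -> reach (C * m.+1) F 1.
Proof.
move=> hws; have [h h0 hE] := dual_alg_derivations hws.
pose X a := exists C, forall m F, box m.+1 ws F -> F <> 0 ->
  reach (C * m.+1) F (a ^+ (C * m.+1)).
have Xh : X h.
  (* One constant has to bound the order and be the exponent. [box_reach] gives an exponent twice
     the order, so the exponent decides. *)
  exists (2 * size ws)%N => m F bF F0.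
  have := box_reach charK hws hE bF F0 0; rewrite expr0 mul1r add0n.
  have -> : (2 * (m.+1 * size ws) = 2 * size ws * m.+1)%N by lia.
  by apply: reachW; nia.
have Xideal : is_ideal X.
  split=> [|a b [C hC] [C' hC']|a b [C hC]].
  - by exists 1%N => m F _ _; rewrite mul1n expr0n; apply: ideal0; apply: reach_ideal.
  (* In the binomial expansion each term contains a power of a of exponent at least C(m+1) or one of
     b of exponent at least C'(m+1). *)
  - exists (C + C')%N => m F bF F0; have hI := reach_ideal ((C + C') * m.+1) F.
    have ha : reach ((C + C') * m.+1) F (a ^+ (C * m.+1)).
      by apply: reachW (hC _ _ bF F0); rewrite leq_mul2r leq_addr.
    have hb : reach ((C + C') * m.+1) F (b ^+ (C' * m.+1)).
      by apply: reachW (hC' _ _ bF F0); rewrite leq_mul2r leq_addl.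
    rewrite exprDn; apply: (ideal_sum _ hI) => i _; rewrite -mulr_natr.
    apply: (ideal_mulr _ hI); have [le_i|lt_i] := leqP (C' * m.+1) i.
      by apply: (idealMl hI); apply: idealX hI le_i hb.
    apply: (ideal_mulr _ hI); apply: idealX hI _ ha.
    by move: lt_i; move: (nat_of_ord i) => j; rewrite mulnDl; lia.
  - exists C => m F bF F0; rewrite exprMn; apply: idealMl; first exact: reach_ideal.
    exact: hC.
have Xder E r : alg_derivation E -> X r -> X (E r).
  (* With N = C(m+1), [reach_radical_der] turns order N and exponent N into 2N for both. *)
  move=> dE [C hC]; exists (2 * C)%N => m F bF F0.
  have := reach_radical_der charK dE (hC _ _ bF F0).
  by rewrite -mulnDl mulnA addnn -mul2n.
have [N [C hC]] : exists N, X (f ^+ N).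
  apply: contrapT => XN.
  have [|P [XP Pf]] := prime_avoiding_powers (f := f) Xideal.
    by move=> N XfN; apply: XN; exists N.
  apply: h0; apply: (stable_ideal_eq0 gen charK (regf Pf) _ Xideal Xder XP Xh).
  move=> a b /loc_inj_eq[u Pu e]; apply/eqP; rewrite -subr_eq0; apply/eqP.
  have ue : u * (a - b) = 0 by rewrite mulrBr e subrr.
  have [u0|//] := domR ue.
  by move: Pu; rewrite u0 idealr0.
(* Order C(m+1) leads from F to f^(NC(m+1)), and [c] times that exponent leads on to 1. *)
exists (C + c * (N * C))%N => m F bF F0.
rewrite mulnDl; apply: reach_trans (hC _ _ bF F0) _.
by rewrite -exprM -!mulnA; apply: reachf.
Qed.

End EffectiveSimplicity.

(** * Counting dimensions *)

Section Counting.
Variables (K : fieldType) (R : comAlgType K).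

(** The coordinates of the [v t] modulo [W] form a matrix with #|T| rows and k columns. If #|T| > k,
    a nonzero vector of its left kernel gives a nontrivial combination of the [v t] in [W]. *)
Lemma quotient_basis_ge (W : R -> Prop) k (e : 'I_k -> R) (T : finType) (v : T -> R) :
    (forall (I : finType) (c : I -> K) (w : I -> R), (forall i, W (w i)) ->
       W (\sum_i c i *: w i)) ->
    quotient_basis W e ->
    (forall c : T -> K, W (\sum_t c t *: v t) -> forall t, c t = 0) ->
  (#|T| <= k)%N.
Proof.
move=> hW [_ span] indep; rewrite leqNgt; apply/negP => lt_k.
have /choice[A hA] t : exists a : 'I_k -> K, W (v t - \sum_i a i *: e i) by exact: span.
pose M : 'M[K]_(#|T|, k) := \matrix_(s, i) A (enum_val s) i.
have ker0 : kermx M != 0.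
  rewrite -mxrank_eq0 mxrank_ker subn_eq0 -ltnNge.
  exact: leq_ltn_trans (rank_leq_col M) lt_k.
have [i rowi] : exists i, row i (kermx M) != 0.
  apply/existsP; rewrite -negb_forall; apply: contra ker0 => /forallP h.
  by apply/eqP/row_matrixP => i; rewrite row0; apply/eqP.
set y := row i _ in rowi; have yM : y *m M = 0.
  by rewrite -row_mul mulmx_ker row0.
pose c t := y 0 (enum_rank t).
have c0 : forall t, c t = 0.
  apply: indep.
  have -> : \sum_t c t *: v t = \sum_t c t *: (v t - \sum_i A t i *: e i).
    rewrite [RHS](eq_bigr _ (fun t _ => scalerBr _ _ _)) sumrB.
    rewrite [X in _ - X](_ : _ = 0) ?subr0 //.
    under eq_bigr do rewrite scaler_sumr.
    rewrite exchange_big big1 //= => j _.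
    under eq_bigr do rewrite scalerA.
    have cA0 : \sum_t c t * A t j = 0.
      transitivity ((y *m M) 0 j); last by rewrite yM mxE.
      rewrite [RHS]mxE (reindex (fun s : 'I_#|T| => enum_val s)) /=.
        by apply: eq_bigr => s _; rewrite /c enum_valK [M _ _]mxE.
      exact/onW_bij/enum_val_bij.
    by rewrite -scaler_suml cA0 scale0r.
  by apply: hW.
case/eqP: rowi; apply/rowP => s; rewrite [RHS]mxE.
by have := c0 (enum_val s); rewrite /c enum_valK.
Qed.

Variable G : nat -> submodClosed R.
Hypotheses (gradedR : grading G).

Lemma diff_power_lin m (I : finType) (c : I -> K) (w : I -> R) :
  (forall i, diff_power G m (w i)) -> diff_power G m (\sum_i c i *: w i).
Proof.
move=> hw delta hd; have ld := diffop_linear hd.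
elim/big_ind: _ => [|a b ha hb|i _].
- have -> : delta 0 = 0 by have := ld (-1) 0 0; rewrite scaler0 addr0 scaleN1r addNr.
  exact: deg_ge0.
- have -> : delta (a + b) = delta a + delta b by have := ld 1 a b; rewrite !scale1r.
  exact: irrelevantD.
- have -> : delta (c i *: w i) = c i *: delta (w i).
    have d0 : delta 0 = 0 by have := ld (-1) 0 0; rewrite scaler0 addr0 scaleN1r addNr.
    by have := ld (c i) (w i) 0; rewrite d0 !addr0.
  by apply: irrelevantZ; apply: hw.
Qed.

(** An operator sending F to 1 keeps F out of the differential power. The strict bound on C(m+1) is
    there because [diff_power G N] tests operators of order N - 1. *)
Lemma quotient_dim_ge (RR : realType) C (ws : seq R) :
    aind (fun r => r = 0) ws ->
    (forall m F, box m.+1 ws F -> F <> 0 -> reach (C * m.+1) F 1) ->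
  forall m N, (C * m.+1 < N)%N ->
  (((m.+1 ^ size ws)%N%:R%:E : \bar RR) <= quotient_dim RR (diff_power G N))%E.
Proof.
move=> hws hreach m N lt_N.
have [T [v [cT bT fT]]] := box_family m.+1 hws.
(* Without a finite basis [quotient_dim] has its default value +oo, and the bound is trivial. *)
rewrite /quotient_dim; case: xgetP => [_ _ [k [e [be ->]]]|_]; last by rewrite leey.
rewrite lee_fin ler_nat -cT; apply: (quotient_basis_ge _ be).
  exact: diff_power_lin.
move=> d hd; apply: fT; apply: contrapT => d0.
have [delta hdelta d1] := hreach _ _ (bT d) d0.
apply: (irrelevant1 gradedR); rewrite -d1; apply: hd.
by apply: diffopW hdelta; lia.
Qed.

End Counting.

Lemma limn_esup_pos (RR : realType) (u : nat -> \bar RR) (eps : RR) N0 : 0 < eps ->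
  (forall N, (N0 <= N)%N -> (eps%:E <= u N)%E) -> (0 < limn_esup u)%E.
Proof.
move=> eps0 hu; apply: (@lt_le_trans _ _ eps%:E); first by rewrite lte_fin.
rewrite limn_esup_lim; apply: lime_ge; first exact: is_cvg_esups.
apply: nearW => n; apply: (le_trans (hu (maxn n N0) (leq_maxr _ _))).
by apply: ereal_sup_ubound; exists (maxn n N0) => //=; apply: leq_maxl.
Qed.

Lemma limn_esup_growth (RR : realType) (d C : nat) (q : nat -> \bar RR) :
    (forall m N, (C * m.+1 < N)%N -> ((m.+1 ^ d)%N%:R%:E <= q N)%E) ->
  (0 < limn_esup (fun n => ((d`!%:R / n%:R ^+ d)%:E * q n)%E))%E.
Proof.
(* For N >= B take m + 1 to be the integer part of N / B. Then C(m+1) < N <= 2B(m+1), so each term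
   is at least d! / (2B)^d. *)
move=> hq; pose B := C.+1; pose eps : RR := d`!%:R / (2 * B)%:R ^+ d.
have fact0 : 0 < d`!%:R :> RR by rewrite ltr0n fact_gt0.
have eps0 : 0 < eps by rewrite divr_gt0 // exprn_gt0 // ltr0n.
apply: (limn_esup_pos (N0 := B) eps0) => N le_BN.
have N0 : (0 < N)%N by apply: leq_trans le_BN.
have : (0 < N %/ B)%N by rewrite divn_gt0.
case em : (N %/ B)%N => [//|m] _.
have ltN := divn_eq N B; have ltB := ltn_pmod N (isT : (0 < B)%N).
have {}ltN : (N <= 2 * B * m.+1)%N by rewrite ltN em; nia.
have lt_C : (C * m.+1 < N)%N.
  have := leq_trunc_div N B; rewrite em mulnC; apply: leq_trans.
  by rewrite mulSn addnC -addn1 leq_add2l.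
have c0 : 0 <= d`!%:R / N%:R ^+ d :> RR by rewrite divr_ge0 ?exprn_ge0 ?ler0n.
apply: le_trans (lee_wpmul2l _ (hq m N lt_C)); last by rewrite lee_fin.
rewrite -EFinM lee_fin -mulrA ler_pM2l // ler_pdivlMl ?exprn_gt0 ?ltr0n //.
rewrite ler_pdivrMr ?exprn_gt0 ?ltr0n // -natrX -natrX -natrM ler_nat.
rewrite -expnMn mulnC; elim: (d) => // e IH; rewrite !expnS; exact: leq_mul.
Qed.

Theorem theorem1p5 (RR : realType) (K : fieldType) (R : comAlgType K)
    (G : nat -> submodClosed R)
    (charK : [pchar K] =i pred0)
    (fgR : fin_gen_alg R)
    (gradedR : grading G) (connectedR : grading_connected G)
    (exf : exists (f : R) (hf : GRing.lreg f) (b : {poly K}),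
        [/\ in_singular_locus f,
            is_bs_poly hf b
          & forall n : nat, ~~ root b n%:R]) :
  (0 < diff_signature RR G)%E.
Proof.
have [n [g gen]] := fgR.
have [f [hf [b [sing [_ bs _] nroot]]]] := exf.
have [c reachf] := bs_reach bs nroot.
have regf (P : prime_idealr R) : f \notin P -> regular_local_ring (loc_at P).
  by move=> /negP Pf; apply: contrapT => /sing.
have domR := graded_domain gradedR connectedR hf
  (fun P Pf => regular_loc_domain gen charK (regf P Pf)) (fun m => ex_intro (fun k => reach k (f ^+ m) 1) _ (reachf m)).
have [ws [sz_ws hws]] := aind_krull_dim R.
have [C hC] := effective_simplicity charK gen domR regf reachf hws.
apply: (limn_esup_growth (C := C)) => m N lt_N.
rewrite -sz_ws; exact: (quotient_dim_ge gradedR RR hws hC lt_N).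
Qed.
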